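(* Let $T>0$, $d=1$, $\Omega=(0,T)\subset\mathbb{R}$, $n\ge 1$, and let $|\cdot|_K$ be a norm on $\mathbb{R}^n$ with closed unit ball $K=\{b\in\mathbb{R}^n : |b|_K\le 1\}$. Let $$\mathcal{B}_K=\big\{[u]\in \mathrm{BV}(\Omega;\mathbb{R}^n)/(\mathbb{R}^n\mathbf{1}_\Omega)\ :\ \mathrm{TV}_K(u)\le 1\big\}.$$ Then $$\mathrm{Ext}(\mathcal{B}_K)=\big\{\,[\,b\,\mathbf{1}_{(t,T)}\,]\ :\ t\in(0,T),\ b\in\mathrm{Ext}(K)\,\big\}.$$
   Context: For $u\in \mathrm{BV}(\Omega;\mathbb{R}^n)$ with $\Omega=(0,T)$, $$\mathrm{TV}_K(u)=\sup\Big\{\int_\Omega u\cdot\Phi'\,dx\ :\ \Phi\in C^1_c(\Omega;\mathbb{R}^n),\ |\Phi(x)|_{K^\circ}\le 1\ \text{for all }x\in\Omega\Big\},$$ where $|a|_{K^\circ}=\sup\{a\cdot b: |b|_K\le 1\}$ is the dual norm. $\mathbf{1}_E$ denotes the indicator function of $E$, and $[u]=\{u+a\mathbf{1}_\Omega : a\in\mathbb{R}^n\}$ is the equivalence class of $u$ modulo constant functions. $\mathrm{Ext}(C)$ denotes the set of extremal points of a convex set $C$: points $u\in C$ such that $u=\lambda u_1+(1-\lambda)u_2$ with $u_1,u_2\in C$, $\lambda\in[0,1]$ implies $u=u_1$ or $u=u_2$. *)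

(* Defs.v *)
From HB Require Import structures.
From mathcomp Require Import all_boot all_order all_algebra.
From mathcomp Require Import all_classical all_reals all_analysis.
Set Implicit Arguments.
Unset Strict Implicit.
Unset Printing Implicit Defensive.
Import Order.TTheory GRing.Theory Num.Theory.
Import numFieldNormedType.Exports.
Local Open Scope classical_set_scope.
Local Open Scope ring_scope.
Local Open Scope quotient_scope.

Definition Ext (R : realType) (V : lmodType R) (C : set V) : set V :=
  [set u | C u /\ forall (u1 u2 : V) (l : R), C u1 -> C u2 -> 0 <= l <= 1 ->
    u = l *: u1 + (1 - l) *: u2 -> u = u1 \/ u = u2].

Section BoundedVariation.
Context {R : realType}.

Definition dot (n : nat) (a b : 'rV[R]_n) : R := \sum_i a ord0 i * b ord0 i.

Record is_norm (n : nat) (N : 'rV[R]_n -> R) : Prop := IsNorm {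
  is_norm_triangle : forall a b, N (a + b) <= N a + N b;
  is_norm_homog : forall (c : R) a, N (c *: a) = `|c| * N a;
  is_norm_eq0 : forall a, N a = 0 -> a = 0 }.

Definition euclid (n : nat) (a : 'rV[R]_n) : R := Num.sqrt (dot a a).

Definition unit_ball (n : nat) (N : 'rV[R]_n -> R) : set 'rV[R]_n :=
  [set b | N b <= 1].

Definition dual_norm (n : nat) (N : 'rV[R]_n -> R) (a : 'rV[R]_n) : \bar R :=
  ereal_sup [set (dot a b)%:E | b in unit_ball N].

Definition Omega (T : R) : set R := `]0, T[.

(* C^1_c(]0, T[; R^n), each test function being extended by 0 to the line *)
Definition C1c (T : R) (n : nat) (Phi : R -> 'rV[R]_n) : Prop :=
  [/\ forall x, derivable Phi x 1,
      continuous (derive1 Phi),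
      compact (closure [set x | Phi x != 0]) &
      closure [set x | Phi x != 0] `<=` Omega T].

Definition TV (T : R) (n : nat) (N : 'rV[R]_n -> R) (u : R -> 'rV[R]_n) :
    \bar R :=
  ereal_sup [set (\int[lebesgue_measure]_(x in Omega T)
                   (dot (u x) (derive1 Phi x))%:E)%E
    | Phi in [set Phi | C1c T Phi /\
                forall x, Omega T x -> (dual_norm N (Phi x) <= 1)%E]].

(* The total variation with respect to the Euclidean norm, which is its own
   dual norm, determines BV(]0, T[; R^n). *)
Definition BV (T : R) (n : nat) (u : R -> 'rV[R]_n) : Prop :=
  (forall i, lebesgue_measure.-integrable (Omega T)
               (fun x => (u x ord0 i)%:E)) /\
  (TV T (@euclid n) u < +oo)%E.

(* the functions equal on ]0, T[, up to a null set, to some constant in R^n *)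
Definition aeconst (T : R) (n : nat) : {pred (R -> 'rV[R]_n)} :=
  fun w => `[< exists a : 'rV[R]_n,
    \forall x \ae lebesgue_measure, Omega T x -> w x = a >].

Fact ae_lebesgue_filter : Filter (almost_everywhere (@lebesgue_measure R)).
Proof. exact: (@ae_filter_ringOfSetsType _ _ _ (@lebesgue_measure R)). Qed.

Lemma aeconst_submod (T : R) (n : nat) : submod_closed (@aeconst T n).
Proof.
split; first by apply/asboolP; exists 0; apply: aeW.
move=> c u v /asboolP[a ua] /asboolP[b vb].
apply/asboolP; exists (c *: a + b).
apply: (@filterS2 _ _ ae_lebesgue_filter _ _ _ _ ua vb) => x uxa vxb xT.
by rewrite -uxa // -vxb.
Qed.

HB.instance Definition _ (T : R) (n : nat) :=
  GRing.isSubmodClosed.Build R (R -> 'rV[R]_n) (@aeconst T n)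
    (@aeconst_submod T n).

(* All functions on the line modulo [aeconst]: the space
   BV(]0, T[; R^n)/(R^n 1) is the linear subspace of the classes having a
   representative in [BV T]. *)
Definition mod_const (T : R) (n : nat) : Type := Quotient.quot (@aeconst T n).
HB.instance Definition _ (T : R) (n : nat) := GRing.Zmodule.on (mod_const T n).

Definition cls (T : R) (n : nat) (u : R -> 'rV[R]_n) : mod_const T n :=
  \pi_(Quotient.quot (@aeconst T n)) u.

Fact cls_eq (T : R) (n : nat) (u v : R -> 'rV[R]_n) :
  cls T u = cls T v <-> u - v \in @aeconst T n.
Proof. by rewrite Quotient.idealrBE; split=> /eqP. Qed.

Lemma clsP (T : R) (n : nat) (u v : R -> 'rV[R]_n) :
  cls T u = cls T v <-> exists a : 'rV[R]_n,
    \forall x \ae lebesgue_measure, Omega T x -> u x = v x + a.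
Proof.
split=> [/cls_eq/asboolP[a h]|[a h]].
  by exists a; apply: (@filterS _ _ ae_lebesgue_filter _ _ _ h) => x hx xT; rewrite -hx // addrC subrK.
apply/cls_eq/asboolP; exists a; apply: (@filterS _ _ ae_lebesgue_filter _ _ _ h) => x hx xT.
by rewrite [LHS](_ : _ = u x - v x) // hx // addrAC subrr add0r.
Qed.

Fact cls_ind (T : R) (n : nat) (P : mod_const T n -> Prop) :
  (forall u, P (cls T u)) -> forall q, P q.
Proof. by move=> h q; rewrite -[q]reprK; apply: h. Qed.

Lemma clsD (T : R) (n : nat) (u v : R -> 'rV[R]_n) :
  cls T (u + v) = cls T u + cls T v.
Proof. exact: (raddfD (\pi_(Quotient.quot (@aeconst T n)))). Qed.

Section Scale.
Variables (T : R) (n : nat).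

Definition mod_const_scale (a : R) (q : mod_const T n) : mod_const T n :=
  cls T (a *: repr q).

Fact scale_cls (a : R) (u : R -> 'rV[R]_n) :
  mod_const_scale a (cls T u) = cls T (a *: u).
Proof. by apply/cls_eq; rewrite -scalerBr rpredZ //; apply/cls_eq; exact: reprK. Qed.

Fact mod_const_scaleA (a b : R) (q : mod_const T n) :
  mod_const_scale a (mod_const_scale b q) = mod_const_scale (a * b) q.
Proof. by elim/cls_ind: q => u; rewrite !scale_cls scalerA. Qed.

Fact mod_const_scale1 : left_id 1 mod_const_scale.
Proof. by elim/cls_ind => u; rewrite scale_cls scale1r. Qed.

Fact mod_const_scaleDr : right_distributive mod_const_scale +%R.
Proof.
move=> a; elim/cls_ind => u; elim/cls_ind => v.
by rewrite -clsD !scale_cls scalerDr clsD.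
Qed.

Fact mod_const_scaleDl (q : mod_const T n) :
  {morph mod_const_scale^~ q : a b / a + b}.
Proof.
by move=> a b; elim/cls_ind: q => u; rewrite !scale_cls scalerDl clsD.
Qed.

HB.instance Definition _ := GRing.Zmodule_isLmodule.Build R (mod_const T n)
  mod_const_scaleA mod_const_scale1 mod_const_scaleDr mod_const_scaleDl.

Lemma clsZ (a : R) (u : R -> 'rV[R]_n) : cls T (a *: u) = a *: cls T u.
Proof. by rewrite -[LHS]scale_cls. Qed.

End Scale.

Definition TV_ball (T : R) (n : nat) (N : 'rV[R]_n -> R) : set (mod_const T n) :=
  [set cls T u | u in [set u | BV T u /\ (TV T N u <= 1)%E]].

Definition step (T : R) (n : nat) (t : R) (b : 'rV[R]_n) : R -> 'rV[R]_n :=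
  fun x => \1_(`]t, T[ : set R) x *: b.

End BoundedVariation.

Arguments TV_ball {R} T {n} N _.

(* Main.v *)
Require Import Defs.
From mathcomp Require Import all_boot all_order all_algebra.
From mathcomp Require Import all_classical all_reals all_analysis.
From mathcomp Require Import measurable_realfun.
From mathcomp Require Import ring lra.
Import Order.TTheory GRing.Theory Num.Theory.
Import numFieldNormedType.Exports.
Local Open Scope classical_set_scope.
Local Open Scope ring_scope.

(** Test functions for the total variation may be localized, and this settles
    both inclusions.

    An extremal class is a step. At a Lebesgue point s of u, two admissible
    test functions can be glued across s at an arbitrarily small cost, so the
    variations of the parts of u before and after s add up to at most the
    variation of u ([TV_cut]). Hence [u] is a convex combination of the
    normalized parts, and extremality leaves three cases: u is constant before
    s, constant after s, or a step with jump at s ([extreme_trichotomy]). If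
    the last case never occurs, the jump point is the supremum of the points
    before which u is constant ([extreme_is_step]).

    A step with jump b at t, where b is extremal in K, is extremal. Let p be a
    linear functional below the norm with p(b) = |b|_K = 1
    ([support_functional]). A test function with value - p at t gives the
    integral 1 on the step, and at most 1 on every element of the ball; if the
    step is a proper convex combination of u1 and u2, it therefore gives 1 on u1
    and on u2. As such a test function can be altered away from t without losing
    admissibility, u1 and u2 have no variation there ([saturated_step]), so they
    are steps at t, and their jumps, of norm at most 1 ([jump_le]), average to
    b.

    Both halves need that no variation means no change of value: a function
    whose integral against the derivative of every admissible test function
    supported in an interval is at most 0 takes the same value at all its
    Lebesgue points there ([leb_pt_const]). *)

(** * Supporting functionals of a norm *)

Section Support.
Context {R : realType}.

Section Dot.
Context {n : nat}.
Implicit Types a b c : 'rV[R]_n.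

Lemma dotC a b : dot a b = dot b a.
Proof. by apply: eq_bigr => i _; rewrite mulrC. Qed.

Lemma dotDl a b c : dot (a + b) c = dot a c + dot b c.
Proof. by rewrite /dot -big_split; apply: eq_bigr => i _; rewrite mxE mulrDl. Qed.

Lemma dotZl (k : R) a c : dot (k *: a) c = k * dot a c.
Proof. by rewrite /dot mulr_sumr; apply: eq_bigr => i _; rewrite mxE mulrA. Qed.

Lemma dotDr a b c : dot c (a + b) = dot c a + dot c b.
Proof. by rewrite dotC dotDl !(dotC c). Qed.

Lemma dotZr (k : R) a c : dot c (k *: a) = k * dot c a.
Proof. by rewrite dotC dotZl (dotC c). Qed.

Lemma dotNl a c : dot (- a) c = - dot a c.
Proof. by rewrite -scaleN1r dotZl mulN1r. Qed.

Lemma dotNr a c : dot c (- a) = - dot c a.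
Proof. by rewrite dotC dotNl dotC. Qed.

Lemma dot0l c : dot 0 c = 0.
Proof. by rewrite -(scale0r c) dotZl mul0r. Qed.

End Dot.

Section Sublinear.
Context {V : lmodType R}.
Implicit Types (p : V -> R) (v w x y : V).

Definition sublinear p :=
  (forall x y, p (x + y) <= p x + p y) /\
  (forall (c : R) x, 0 <= c -> p (c *: x) = c * p x).

Lemma sublinear0 p : sublinear p -> p 0 = 0.
Proof. by case=> _ /(_ 0 0 (lexx 0)); rewrite scale0r mul0r. Qed.

Lemma sublinearN p x : sublinear p -> - p (- x) <= p x.
Proof.
move=> sp; have := sp.1 x (- x); rewrite subrr sublinear0 // => h.
by rewrite lerNl -subr_ge0 opprK addrC.
Qed.

(** The largest sublinear functional below p whose value at - v is at most
    - p v; sublinearity then forces it to be odd along v. *)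
Definition linearize p v x : R :=
  inf [set p (x + t *: v) - t * p v | t in [set t | 0 <= t]].

Lemma linearize_lb p v x : sublinear p ->
  lbound [set p (x + t *: v) - t * p v | t in [set t | 0 <= t]] (- p (- x)).
Proof.
move=> sp _ [t /= t0 <-]; have := sp.1 (x + t *: v) (- x).
by rewrite addrAC subrr add0r sp.2 //; lra.
Qed.

Lemma linearize_le p v x (t : R) : sublinear p -> 0 <= t ->
  linearize p v x <= p (x + t *: v) - t * p v.
Proof.
move=> sp t0; apply: ge_inf; first by exists (- p (- x)); exact: linearize_lb.
by exists t.
Qed.

Lemma le_linearize p v x (c : R) :
  (forall t, 0 <= t -> c <= p (x + t *: v) - t * p v) -> c <= linearize p v x.
Proof.
move=> h; apply: lb_le_inf; first by exists (p (x + 0 *: v) - 0 * p v), 0 => /=.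
by move=> _ [t /= t0 <-]; exact: h.
Qed.

Lemma linearize_leW p v x : sublinear p -> linearize p v x <= p x.
Proof.
by move=> sp; have := linearize_le p v x 0 sp (lexx 0);
  rewrite scale0r addr0 mul0r subr0.
Qed.

(** Subadditivity holds because the infima for x and y are approached with
    parameters t and s, and t + s is a parameter for x + y. Homogeneity comes
    from rescaling t. *)
Lemma linearize_sublinear p v : sublinear p -> sublinear (linearize p v).
Proof.
move=> sp.
have hZ (c : R) x : 0 < c -> c * linearize p v x <= linearize p v (c *: x).
  move=> c0; apply: le_linearize => t t0.
  have tc0 : 0 <= c^-1 * t by rewrite mulr_ge0 // invr_ge0 ltW.
  have := linearize_le p v x _ sp tc0.
  rewrite -(ler_pM2l c0) => /le_trans; apply.
  rewrite mulrBr -(sp.2 c (x + _) (ltW c0)) scalerDr scalerA !mulrA.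
  by rewrite mulfV ?gt_eqF // !mul1r.
split=> [x y|c x].
  rewrite -lerBlDr; apply: le_linearize => t t0.
  rewrite lerBlDr -lerBlDl; apply: le_linearize => s s0.
  rewrite lerBlDl.
  apply: le_trans (linearize_le p v (x + y) (t + s) sp (addr_ge0 t0 s0)) _.
  rewrite scalerDl addrACA.
  have := sp.1 (x + t *: v) (y + s *: v); lra.
rewrite le_eqVlt => /orP[/eqP <-|c0].
  rewrite scale0r mul0r; apply/eqP; rewrite eq_le; apply/andP; split.
    by rewrite -(sublinear0 _ sp); exact: linearize_leW.
  apply: le_linearize => t t0; have := linearize_lb p v 0 sp.
  rewrite oppr0 (sublinear0 _ sp) oppr0; apply; by exists t.
apply/eqP; rewrite eq_le; apply/andP; split; last exact: hZ.
have ci0 : 0 < c^-1 by rewrite invr_gt0.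
have := hZ c^-1 (c *: x) ci0; rewrite scalerA mulVf ?gt_eqF // scale1r.
by rewrite -(ler_pM2l c0) mulrA mulfV ?gt_eqF // mul1r.
Qed.

Lemma linearize_odd p v : sublinear p ->
  linearize p v v = p v /\ linearize p v (- v) = - p v.
Proof.
move=> sp; have sq := linearize_sublinear p v sp.
have h1 := linearize_leW p v v sp.
have := linearize_le p v (- v) 1 sp ler01.
rewrite scale1r addNr sublinear0 // mul1r sub0r => h2.
have := sublinearN _ v sq => h3.
by split; apply/eqP; rewrite eq_le; apply/andP; split => //; lra.
Qed.

(** Oddness along a vector survives when p is made smaller: this is what allows
    the vectors to be treated one after the other. *)
Lemma sublinear_odd_le p q v : sublinear q -> (forall x, q x <= p x) ->
  p (- v) = - p v -> q v = p v /\ q (- v) = - q v.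
Proof.
move=> sq qp pv; have := sublinearN _ v sq; have := qp v; have := qp (- v).
by rewrite pv => h1 h2 h3; split; lra.
Qed.

(** Linearizing along the entries of s in turn. *)
Lemma sublinear_odd_seq p (s : seq V) : sublinear p ->
  exists q, [/\ sublinear q, forall x, q x <= p x &
    forall v, v \in s -> q (- v) = - q v].
Proof.
elim: s p => [|v s IH] p sp; first by exists p; split.
have [q [sq qp qs]] := IH _ (linearize_sublinear p v sp).
exists q; split => // [x|w]; first exact: le_trans (qp x) (linearize_leW _ _ _ sp).
rewrite inE => /orP[/eqP ->|]; last exact: qs.
have [e1 e2] := linearize_odd p v sp.
by have [] := sublinear_odd_le _ _ v sq qp; rewrite ?e1.
Qed.

End Sublinear.

Lemma is_norm_sublinear n (N : 'rV[R]_n -> R) : is_norm N -> sublinear N.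
Proof.
by move=> hN; split=> [|c x c0];
  [exact: (is_norm_triangle hN)|rewrite (is_norm_homog hN) ger0_norm].
Qed.

Lemma is_normN n (N : 'rV[R]_n -> R) a : is_norm N -> N (- a) = N a.
Proof. by move=> hN; rewrite -scaleN1r (is_norm_homog hN) normrN1 mul1r. Qed.

Lemma is_norm_ge0 n (N : 'rV[R]_n -> R) a : is_norm N -> 0 <= N a.
Proof.
move=> hN; have := sublinearN N a (is_norm_sublinear _ N hN).
by rewrite is_normN //; lra.
Qed.

(** The Hahn-Banach theorem in finite dimension. Linearize N along b, which
    keeps the value N b, and then along the basis vectors: a sublinear
    functional that is odd along a basis is linear. *)
Lemma support_functional n (N : 'rV[R]_n -> R) (b : 'rV[R]_n) : sublinear N ->
  exists p, dot p b = N b /\ forall c, dot p c <= N c.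
Proof.
move=> sN; pose e (i : 'I_n) : 'rV[R]_n := delta_mx 0 i.
have [q [sq qp qs]] :=
  sublinear_odd_seq _ [seq e i | i <- enum 'I_n] (linearize_sublinear N b sN).
have qe i : q (- e i) = - q (e i) by apply: qs; apply: map_f; rewrite mem_enum.
have le_lin x : q x <= \sum_i q (e i) * x ord0 i.
  rewrite {1}(row_sum_delta x).
  elim/big_ind2: _ => [|x1 y1 x2 y2 h1 h2|i _]; first by rewrite (sublinear0 _ sq).
    exact: le_trans (sq.1 _ _) (lerD h1 h2).
  have [x0|x0] := leP 0 (x 0 i); first by rewrite (sq.2 _ _ x0) mulrC.
  have Nx0 : 0 <= - x 0 i by rewrite oppr_ge0 ltW.
  by rewrite -[X in q X]opprK -scalerN -scaleNr (sq.2 _ _ Nx0) qe mulrNN mulrC.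
have [e1 e2] := linearize_odd N b sN.
have [qb1 qb2] := sublinear_odd_le _ _ b sq qp (etrans e2 (congr1 _ (esym e1))).
exists (\row_i q (e i)).
have dqE x : dot (\row_i q (e i)) x = q x.
  have dE y : dot (\row_i q (e i)) y = \sum_i q (e i) * y ord0 i.
    by apply: eq_bigr => i _; rewrite mxE.
  apply/eqP; rewrite eq_le dE le_lin andbT.
  have h : q (- x) <= - \sum_i q (e i) * x ord0 i by rewrite -dE -dotNr dE.
  have := sublinearN _ x sq; lra.
split=> [|c]; first by rewrite dqE qb1 e1.
by rewrite dqE (le_trans (qp c)) // linearize_leW.
Qed.

Lemma dual_norm_leP n (N : 'rV[R]_n -> R) (a : 'rV[R]_n) :
  (dual_norm N a <= 1)%E <-> forall b, N b <= 1 -> dot a b <= 1.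
Proof.
split=> [h b Nb|h].
  by rewrite -lee_fin (le_trans _ h) //; apply: ereal_sup_ubound; exists b.
by apply: ge_ereal_sup => _ [b /= Nb <-]; rewrite lee_fin h.
Qed.

End Support.

(** * A continuously differentiable cutoff on the line *)

Section Ramp.
Context {R : realType}.
Implicit Types x y z a e : R.

(** A quadratic error bound handles the points where max(x, 0)^2 changes its
    formula in the same way as all the others. *)
Lemma is_derive_quadratic (f : R -> R) x (l C : R) :
  (forall h, `|f (x + h) - f x - l * h| <= C * h ^+ 2) -> is_derive x 1 f l.
Proof.
move=> fC.
have cvg_l : h^-1 *: ((f \o shift x) (h *: 1) - f x) @[h --> 0^'] --> l.
  apply/cvgrPdist_le => /= eps eps0.
  have d0 : 0 < eps / (`|C| + 1) by rewrite divr_gt0 // ltr_wpDl.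
  near=> h.
  have h0 : h != 0 by near: h; exact: nbhs_dnbhs_neq.
  have hd : `|h| <= eps / (`|C| + 1) by near: h; exact: dnbhs0_le.
  rewrite -(ler_pM2r (_ : 0 < `|h|)) ?normr_gt0 // -normrM.
  have -> : (l - h^-1 *: (f (h *: 1 + x) - f x)) * h =
      - (f (x + h) - f x - l * h).
    by rewrite /GRing.scale /= mulr1 (addrC h x); field.
  rewrite normrN (le_trans (fC h)) // -(real_normK (num_real h)) expr2 mulrA.
  rewrite ler_wpM2r // (le_trans (ler_wpM2r _ (ler_norm C))) //.
  move: hd; rewrite ler_pdivlMr ?ltr_wpDl // => /(le_trans _); apply.
  by rewrite mulrC ler_wpM2l // lerDl.
apply: DeriveDef; first by apply/cvg_ex; exists l.
exact: cvg_lim cvg_l.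
Unshelve. all: by end_near. Qed.

Definition pospart x : R := Num.max x 0.

(** A quadratic spline with knots 0, 1/2, 1, rising from 0 to 1 with continuous
    derivative. *)
Definition spline x : R :=
  2 * (pospart x ^+ 2 - 2 * pospart (x - 2^-1) ^+ 2 + pospart (x - 1) ^+ 2).

Definition hat x : R :=
  4 * (pospart x - 2 * pospart (x - 2^-1) + pospart (x - 1)).

Lemma pospart_le0 x : x <= 0 -> pospart x = 0.
Proof. exact: max_r. Qed.

Lemma pospart_ge0 x : 0 <= x -> pospart x = x.
Proof. exact: max_l. Qed.

Lemma pospart_quadratic x h :
  `|pospart (x + h) ^+ 2 - pospart x ^+ 2 - 2 * pospart x * h| <= h ^+ 2.
Proof.
by rewrite ler_norml /pospart /Num.max; apply/andP; do 2 (case: ltP => ?); split; nra.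
Qed.

Lemma spline_quadratic x h :
  `|spline (x + h) - spline x - hat x * h| <= 8 * h ^+ 2.
Proof.
have h1 := pospart_quadratic x h.
have h2 := pospart_quadratic (x - 2^-1) h.
have h3 := pospart_quadratic (x - 1) h.
move: h1 h2 h3; rewrite !ler_norml /spline /hat ![x + h - _]addrAC; lra.
Qed.

Lemma spline_le0 x : x <= 0 -> spline x = 0.
Proof.
by move=> x0; rewrite /spline !pospart_le0; [ring|lra..].
Qed.

Lemma spline_ge1 x : 1 <= x -> spline x = 1.
Proof.
by move=> x1; rewrite /spline !pospart_ge0; [field|lra..].
Qed.

Lemma spline_itv x : 0 <= spline x <= 1.
Proof.
by rewrite /spline /pospart /Num.max; apply/andP; do 3 (case: ltP => ?); split; nra.
Qed.

Lemma hat_out x : x <= 0 \/ 1 <= x -> hat x = 0.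
Proof.
by move=> x01; rewrite /hat /pospart /Num.max; do 3 (case: ltP => ?); lra.
Qed.

Lemma hat_le2 x : `|hat x| <= 2.
Proof.
by rewrite ler_norml /hat /pospart /Num.max; apply/andP; do 3 (case: ltP => ?);
  split; lra.
Qed.

Lemma pospart_continuous : continuous pospart.
Proof.
by move=> x; apply: (@continuous_max _ _ id (fun=> 0) x);
  [exact: cvg_id|exact: cvg_cst].
Qed.

Lemma hat_continuous : continuous hat.
Proof.
have c (k : R) : continuous (fun x => pospart (x - k)).
  move=> x; apply: (@continuous_comp _ _ _ (fun x => x - k) pospart).
    by apply: cvgB; [exact: cvg_id|exact: cvg_cst].
  exact: pospart_continuous.
move=> x; apply: cvgM; first exact: cvg_cst.
apply: cvgD; last exact: c.
apply: cvgB; first exact: pospart_continuous.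
by apply: cvgM; [exact: cvg_cst|exact: c].
Qed.

Definition ramp a e z : R := spline ((z - a) / e).
Definition dramp a e z : R := hat ((z - a) / e) / e.

Lemma ramp_le a e z : 0 < e -> z <= a -> ramp a e z = 0.
Proof.
by move=> e0 za; apply: spline_le0; rewrite ler_pdivrMr // mul0r subr_le0.
Qed.

Lemma ramp_ge a e z : 0 < e -> a + e <= z -> ramp a e z = 1.
Proof.
by move=> e0 za; apply: spline_ge1; rewrite ler_pdivlMr // mul1r lerBrDl.
Qed.

Lemma ramp_itv a e z : 0 <= ramp a e z <= 1.
Proof. exact: spline_itv. Qed.

Lemma dramp_out a e z : 0 < e -> z <= a \/ a + e <= z -> dramp a e z = 0.
Proof.
move=> e0 h; rewrite /dramp hat_out ?mul0r //.
case: h => h; [left|right].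
  by rewrite ler_pdivrMr // mul0r subr_le0.
by rewrite ler_pdivlMr // mul1r lerBrDl.
Qed.

Lemma dramp_le a e z : 0 < e -> `|dramp a e z| <= 2 / e.
Proof.
by move=> e0; rewrite normrM (gtr0_norm (_ : 0 < e^-1)) ?invr_gt0 // ler_pM2r
  ?invr_gt0 // hat_le2.
Qed.

Lemma is_derive_ramp a e z : 0 < e -> is_derive z 1 (ramp a e) (dramp a e z).
Proof.
move=> e0; apply: (@is_derive_quadratic _ _ _ (8 / e ^+ 2)) => h.
rewrite /ramp /dramp (_ : (z + h - a) / e = (z - a) / e + h / e); last by ring.
rewrite (_ : hat _ / e * h = hat ((z - a) / e) * (h / e)); last by ring.
rewrite (_ : 8 / e ^+ 2 * h ^+ 2 = 8 * (h / e) ^+ 2); first exact: spline_quadratic.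
by field; rewrite gt_eqF.
Qed.

Lemma dramp_continuous a e : continuous (dramp a e).
Proof.
move=> z; apply: cvgM; last exact: cvg_cst.
apply: (@continuous_comp _ _ _ (fun z => (z - a) / e) hat);
  last exact: hat_continuous.
by apply: cvgM; [apply: cvgB; [exact: cvg_id|]|]; exact: cvg_cst.
Qed.

End Ramp.

(** * Test functions, one coordinate at a time *)

Section TestFunctions.
Context {R : realType}.

Definition C1 (f : R -> R) := (forall x, derivable f x 1) /\ continuous (derive1 f).

Definition supported_in {n : nat} (Phi : R -> 'rV[R]_n) (a b : R) :=
  forall x, Phi x != 0 -> a <= x <= b.

Lemma C1_cst (c : R) : C1 (fun=> c).
Proof.
split=> [x|]; first exact: derivable_cst.
by rewrite (_ : derive1 _ = fun=> 0); [move=> x; exact: cvg_cst|apply/funext => x;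
  rewrite derive1_cst].
Qed.

Lemma derive1D_C1 (f g : R -> R) : C1 f -> C1 g ->
  derive1 (fun x => f x + g x) = fun x => derive1 f x + derive1 g x.
Proof.
move=> [df _] [dg _]; apply/funext => x.
by rewrite !derive1E deriveD.
Qed.

Lemma C1D (f g : R -> R) : C1 f -> C1 g -> C1 (fun x => f x + g x).
Proof.
move=> Cf Cg; split=> [x|]; first by apply: derivableD; [exact: Cf.1|exact: Cg.1].
by rewrite derive1D_C1 // => x; apply: cvgD; [exact: Cf.2|exact: Cg.2].
Qed.

Lemma derive1M_C1 (f g : R -> R) : C1 f -> C1 g ->
  derive1 (fun x => f x * g x) = fun x => f x * derive1 g x + g x * derive1 f x.
Proof.
move=> [df _] [dg _]; apply/funext => x.
by rewrite !derive1E deriveM.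
Qed.

Lemma C1_continuous (f : R -> R) : C1 f -> continuous f.
Proof. by move=> [df _] x; apply/differentiable_continuous/derivable1_diffP. Qed.

Lemma C1M (f g : R -> R) : C1 f -> C1 g -> C1 (fun x => f x * g x).
Proof.
move=> Cf Cg; split=> [x|]; first by apply: derivableM; [exact: Cf.1|exact: Cg.1].
rewrite derive1M_C1 // => x; apply: cvgD.
  by apply: cvgM; [exact: C1_continuous|exact: Cg.2].
by apply: cvgM; [exact: C1_continuous|exact: Cf.2].
Qed.

Lemma derive1_ramp (a e : R) : 0 < e -> derive1 (ramp a e) = dramp a e.
Proof.
by move=> e0; apply/funext => x; have := is_derive_ramp a e x e0; rewrite derive1E;
  case.
Qed.

Lemma C1_ramp (a e : R) : 0 < e -> C1 (ramp a e).
Proof.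
move=> e0; split=> [x|]; first by have := is_derive_ramp a e x e0; case.
by rewrite derive1_ramp //; exact: dramp_continuous.
Qed.

Section Vector.
Context {n : nat}.
Implicit Types (Phi Psi : R -> 'rV[R]_n) (T : R).

Definition coord (i : 'I_n) Phi (x : R) : R := Phi x ord0 i.

Lemma derive1_coord Phi x i : derivable Phi x 1 ->
  derive1 Phi x ord0 i = derive1 (coord i Phi) x.
Proof. by move=> dPhi; rewrite !derive1E derive_mx // mxE. Qed.

(** The support being compact in an open interval, it lies at a positive
    distance from both ends; in this form sums and products of test functions
    are easily seen to be test functions. *)
Lemma C1cP T Phi : 0 < T ->
  C1c T Phi <-> (forall i, C1 (coord i Phi)) /\
    exists a b, [/\ 0 < a, b < T & supported_in Phi a b].
Proof.
move=> T0; split=> [[dPhi cPhi kPhi sPhi]|[CPhi [a [b [a0 bT sPhi]]]]].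
  split=> [i|].
    split=> [x|x]; first exact: (derivable_mxP _ _ _).1.
    rewrite (_ : derive1 _ = (fun M : 'rV[R]_n => M ord0 i) \o derive1 Phi).
      by apply: continuous_comp; [exact: cPhi|exact: coord_continuous].
    by apply/funext => y; rewrite /= derive1_coord.
  pose A := closure [set x | Phi x != 0].
  have [A0|/set0P A0] := eqVneq A set0.
    exists (T / 2), (T / 2); split; [lra|lra|] => x Px.
    by have : A x; [exact: subset_closure|rewrite A0].
  have cid' : {within A, continuous (@idfun R)} by apply: continuous_subspaceT =>
    x; exact: cvg_id.
  have [a aA amin] := compact_EVT_min A0 kPhi cid'.
  have [b bA bmax] := compact_EVT_max A0 kPhi cid'.
  move: aA bA; rewrite !inE => /sPhi; rewrite /Omega /= in_itv /= => /andP[a0 _].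
  move=> /sPhi; rewrite /Omega /= in_itv /= => /andP[_ bT].
  exists a, b; split => // x Px; have xA : x \in A by rewrite inE;
    exact: subset_closure.
  by rewrite (amin _ xA) (bmax _ xA).
have dPhi x : derivable Phi x 1.
  by apply/derivable_mxP => i j; rewrite ord1; exact: (CPhi j).1.
have clab : closure [set x | Phi x != 0] `<=` `[a, b].
  rewrite [X in _ `<=` X](closure_id _).1; last exact: interval_closed.
  by apply: closure_subset => x /= /sPhi; rewrite in_itv.
split; first exact: dPhi.
- move=> x; apply/cvgrPdist_le => /= e e0; near=> y.
  rewrite /Num.Def.normr /= mx_normrE (bigmax_le _ (ltW e0)) //= => -[i j] _.
  rewrite !mxE /= ord1 !derive1_coord //.
  move: j; near: y; apply: filter_forall => /= j.
  exact: (cvgrPdist_le _ _).1 ((CPhi j).2 x) e e0.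
- apply: subclosed_compact clab; [exact: closed_closure|exact: segment_compact].
- apply: subset_trans clab _ => x; rewrite /Omega /= !in_itv /= => /andP[ax xb].
  by rewrite (lt_le_trans a0 ax) (le_lt_trans xb bT).
Unshelve. all: by end_near. Qed.

Lemma coordZ i (f : R -> R) (p : 'rV[R]_n) :
  coord i (fun x => f x *: p) = fun x => f x * p ord0 i.
Proof. by apply/funext => x; rewrite /coord mxE. Qed.

End Vector.
End TestFunctions.

(** * Integrals over the interval *)

Section Integration.
Context {R : realType} (T : R).
Local Notation mu := (@lebesgue_measure R).
Local Notation Om := (Omega T).

Lemma measurable_Omega : measurable (Om : set R).
Proof. exact: measurable_itv. Qed.
Local Hint Resolve measurable_Omega : core.

Lemma Omega_fin : (mu Om < +oo)%E.
Proof. by rewrite lebesgue_measure_itv /=; case: ifP => _; rewrite ltry. Qed.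

Definition L1 (f : R -> R) := mu.-integrable Om (fun x => (f x)%:E).

(** Bounded everywhere, not only essentially: the multipliers are derivatives
    of test functions and indicators of half-lines. *)
Definition Linf (g : R -> R) :=
  measurable_fun Om g /\ exists M, forall x, Om x -> `|g x| <= M.

Lemma Linf_bounded g : Linf g -> [bounded g x | x in Om].
Proof.
move=> [_ [M gM]]; exists M; split; first exact: num_real.
by move=> y My x Ox; apply: le_trans (gM _ Ox) (ltW My).
Qed.

Lemma L1_measurable f : L1 f -> measurable_fun Om f.
Proof. by move=> /(measurable_int mu) /measurable_EFinP. Qed.

Lemma L1M f g : L1 f -> Linf g -> L1 (fun x => f x * g x).
Proof.
move=> f1 gi; rewrite /L1 (_ : (fun x => (f x * g x)%:E) =
  ((fun x => (f x)%:E) \* (EFin \o g))%E).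
  by apply: integrableMl => //; [exact: gi.1|exact: Linf_bounded].
by apply/funext => x /=; rewrite EFinM.
Qed.

Lemma L1D f g : L1 f -> L1 g -> L1 (fun x => f x + g x).
Proof.
by move=> f1 g1; rewrite /L1; under eq_fun do rewrite EFinD; exact: integrableD.
Qed.

Lemma L1Z (c : R) f : L1 f -> L1 (fun x => c * f x).
Proof.
by move=> f1; rewrite /L1; under eq_fun do rewrite EFinM; exact: integrableZl.
Qed.

Lemma Linf_L1 g : Linf g -> L1 g.
Proof.
by move=> gi; apply: measurable_bounded_integrable => //;
  [exact: Omega_fin|exact: gi.1|exact: Linf_bounded].
Qed.

Lemma Linf_cst (c : R) : Linf (fun=> c).
Proof. by split => //; exists `|c|. Qed.

Lemma LinfD f g : Linf f -> Linf g -> Linf (fun x => f x + g x).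
Proof.
move=> [mf [M fM]] [mg [M' gM]]; split; first exact: measurable_funD.
by exists (M + M') => x Ox; rewrite (le_trans (ler_normD _ _)) // lerD ?fM ?gM.
Qed.

Lemma LinfM f g : Linf f -> Linf g -> Linf (fun x => f x * g x).
Proof.
move=> [mf [M fM]] [mg [M' gM]]; split; first exact: measurable_funM.
by exists (M * M') => x Ox; rewrite normrM ler_pM ?fM ?gM.
Qed.

Lemma Linf_continuous g : continuous g -> Linf g.
Proof.
move=> cg; split.
  by apply: measurable_funTS; exact: continuous_measurable_fun.
have [T0|T0] := leP 0 T; last first.
  by exists 0 => x; rewrite /Omega /= in_itv /= => /andP[x0 xT]; lra.
have cn : {within `[0, T], continuous (fun x => `|g x|)}.
  by apply: continuous_subspaceT => x; apply: cvg_norm; exact: cg.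
have [c _ cM] := EVT_max T0 cn.
exists `|g c| => x; rewrite /Omega /= in_itv /= => /andP[x0 xT].
by apply: cM; rewrite in_itv /= !ltW.
Qed.

Lemma Linf_lt (s : R) : Linf (fun x => (x < s)%R%:R).
Proof.
split; last by exists 1 => x _; case: (x < s); rewrite ?normr1 ?normr0 ?ler01.
rewrite (_ : (fun _ => _) = \1_(`]-oo, s[ : set R)); last first.
  by apply/funext => x; rewrite indicE; congr (nat_of_bool _)%:R; apply/idP/idP;
    rewrite inE /= in_itv.
exact: measurable_indic.
Qed.

Lemma integral_derive1 (f : R -> R) (a b : R) : a <= b -> C1 f ->
  \int[mu]_(x in `]a, b[) derive1 f x = f b - f a.
Proof.
rewrite le_eqVlt => /predU1P[-> _|ab [df cf]].
  by rewrite set_itv_ge ?bnd_simp // Rintegral_set0 subrr.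
have cw : {within `[a, b], continuous (derive1 f)} by exact: continuous_subspaceT.
have if' : mu.-integrable `[a, b] (EFin \o derive1 f).
  by apply: continuous_compact_integrable => //; exact: segment_compact.
have cfx x : continuous_at x f.
  by apply/differentiable_continuous/derivable1_diffP.
rewrite Rintegral_itv_bndo_bndc; last first.
  by apply: integrableS if' => //; exact: subset_itvW.
rewrite Rintegral_itv_obnd_cbnd; last first.
  by apply: integrableS if' => // x /=; rewrite !in_itv /= => /andP[/ltW -> ->].
have df' : derivable_oo_LRcontinuous f a b.
  split=> [x _| |]; first exact: df.
    exact: cvg_at_right_filter (cfx a).
  exact: cvg_at_left_filter (cfx b).
by rewrite /Rintegral (continuous_FTC2 ab cw df').
Qed.

Lemma Rintegral_OmegaD (f g : R -> R) : L1 f -> L1 g ->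
  \int[mu]_(x in Om) (f x + g x) =
  \int[mu]_(x in Om) f x + \int[mu]_(x in Om) g x.
Proof. by move=> f1 g1; rewrite RintegralD. Qed.

Lemma Rintegral_OmegaB (f g : R -> R) : L1 f -> L1 g ->
  \int[mu]_(x in Om) (f x - g x) =
  \int[mu]_(x in Om) f x - \int[mu]_(x in Om) g x.
Proof. by move=> f1 g1; rewrite RintegralB. Qed.

Lemma Rintegral_Omega_sum (I : Type) (r : seq I) (F : I -> R -> R) :
  (forall i, L1 (F i)) ->
  \int[mu]_(x in Om) (\sum_(i <- r) F i x) = \sum_(i <- r) \int[mu]_(x in Om) F i x.
Proof.
move=> F1; elim: r => [|i r IH].
  by under eq_Rintegral do rewrite big_nil; rewrite Rintegral_cst // mul0r big_nil.
under eq_Rintegral do rewrite big_cons.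
rewrite RintegralD // ?big_cons ?IH //; first exact: F1.
have := @integrable_sum _ _ _ mu Om measurable_Omega _ r xpredT
  (fun i x => (F i x)%:E) (fun i _ => F1 i).
by apply: eq_integrable => // x _ /=; rewrite sumEFin.
Qed.

(** The integral is at most (M / r) times the integral of |f - f s| over the
    ball of radius r, that is 2 M times a mean value that tends to 0. *)
Lemma lebesgue_pt_kernel (f : R -> R) (s M e : R) : L1 f -> Om s ->
  lebesgue_pt (f \_ Om) s -> 0 < M -> 0 < e ->
  \forall r \near 0^'+, forall g : R -> R, measurable_fun Om g ->
    (forall x, Om x -> `|g x| <= M / r) ->
    (forall x, Om x -> r <= `|x - s| -> g x = 0) ->
    `|\int[mu]_(x in Om) ((f x - f s) * g x)| <= e.
Proof.
move=> f1 Os leb M0 e0.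
have c0 : 0 < e / (2 * M) by rewrite divr_gt0 // mulr_gt0.
have small : \forall r \near 0^'+, (davg (f \_ Om) s r < (e / (2 * M))%:E)%E.
  by apply: (leb [set y | (y < _)%E]); apply: open_ereal_lt'; rewrite lte_fin.
near=> r => g mg gM gs.
have r0 : 0 < r by near: r; exact: nbhs_right_gt.
have gi : Linf g by split => //; exists (M / r).
have h1 : L1 (fun x => (f x - f s) * g x).
  by apply: L1M => //; apply: L1D => //; exact/Linf_L1/Linf_cst.
pose F := f \_ Om.
have FE x : Om x -> F x = f x by move=> Ox; rewrite /F patchE mem_set.
have mF : measurable_fun setT F.
  by apply/(measurable_restrictT _ _).1 => //; exact: L1_measurable.
have mFs : measurable_fun setT (fun x => `|F x - F s|%:E).
  by apply/measurable_EFinP; apply: measurableT_comp => //; exact: measurable_funB.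
rewrite -lee_fin EFin_normr_Rintegral //.
apply: le_trans (le_abse_integral mu _ _) _ => //;
  first exact: (measurable_int mu h1).
have Mr0 : 0 <= M / r by rewrite divr_ge0 ?ltW.
apply: (@le_trans _ _ (\int[mu]_(x in Om)
  (((fun x => (M / r)%:E * `|F x - F s|%:E) \_ (ball s r)) x))%E).
  apply: ge0_le_integral => //.
  - by apply/measurable_EFinP; apply: measurableT_comp => //; exact: L1_measurable h1.
  - apply: measurable_funTS; apply/(measurable_restrictT _ _).1;
      first exact: measurable_ball.
    by apply: measurable_funTS; apply: emeasurable_funM.
  - move=> x Ox; rewrite patchE; case: ifPn => [_|].
      by rewrite /= lee_fin normrM mulrC (FE _ Ox) (FE _ Os) ler_wpM2r // gM.
    rewrite notin_setE /ball /= => /negP; rewrite -leNgt distrC => rx.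
    by rewrite gs // mulr0 normr0.
rewrite -integral_mkcondr.
apply: (@le_trans _ _ (\int[mu]_(x in ball s r) ((M / r)%:E * `|F x - F s|%:E))%E).
  apply: ge0_subset_integral => //.
  - by apply: measurableI => //; exact: measurable_ball.
  - exact: measurable_ball.
  - by apply: measurable_funTS; apply: emeasurable_funM.
  - by move=> x _; rewrite mule_ge0 // lee_fin.
rewrite ge0_integralZl //; [|exact: measurable_ball|exact: measurable_funTS].
have : (davg F s r < (e / (2 * M))%:E)%E by near: r; exact: small.
rewrite /davg /iavg lebesgue_measure_ball; last exact: ltW.
rewrite inver mulrn_eq0 /= gt_eqF //.
set I := (\int[mu]_(y in ball s r) _)%E.
have I0 : (0 <= I)%E by apply: integral_ge0.
move: I0; case: I => [i| |] //; last first.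
  by move=> _; rewrite gt0_muley ?lte_fin ?invr_gt0 ?mulrn_wgt0 // ltNge leey.
rewrite lee_fin -!EFinM lte_fin lee_fin => i0.
rewrite -(mulr_natr r) ltr_pdivlMr ?mulr_gt0 // => /ltW ie.
have rE : r^-1 * i = 2 * ((r * 2)^-1 * i) by field; rewrite gt_eqF.
rewrite -mulrA rE; apply: le_trans ie; rewrite le_eqVlt; apply/orP; left;
  apply/eqP; ring.
Unshelve. all: by end_near. Qed.

End Integration.

(** * The integral that defines the total variation *)

Section Pairing.
Context {R : realType} {n : nat} (T : R).
Local Notation mu := (@lebesgue_measure R).
Local Notation Om := (Omega T).
Local Notation vec := 'rV[R]_n.
Implicit Types (u v G Phi Psi : R -> vec) (N : vec -> R).

Let mOm : measurable (Om : set R) := measurable_Omega T.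
Local Hint Resolve mOm : core.

Definition L1v u := forall i, L1 T (fun x => u x ord0 i).
Definition Linfv G := forall i, Linf T (fun x => G x ord0 i).

Lemma L1v_cst (c : vec) : L1v (fun=> c).
Proof. by move=> i; exact/Linf_L1/Linf_cst. Qed.

Lemma L1vD u v : L1v u -> L1v v -> L1v (u + v).
Proof.
move=> hu hv i; rewrite (_ : (fun _ => _) = fun x => u x ord0 i + v x ord0 i).
  exact: L1D.
by apply/funext => x; rewrite mxE.
Qed.

Lemma L1vZ (k : R) u : L1v u -> L1v (k *: u).
Proof.
move=> hu i; rewrite (_ : (fun _ => _) = fun x => k * u x ord0 i); first exact: L1Z.
by apply/funext => x; rewrite mxE.
Qed.

Lemma L1v_mul (g : R -> R) u : L1v u -> Linf T g -> L1v (fun x => g x *: u x).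
Proof.
move=> hu hg i; rewrite (_ : (fun _ => _) = fun x => u x ord0 i * g x);
  first exact: L1M.
by apply/funext => x; rewrite mxE mulrC.
Qed.

Lemma L1_dot u G : L1v u -> Linfv G -> L1 T (fun x => dot (u x) (G x)).
Proof.
move=> hu hG; rewrite /L1 /dot; under eq_fun do rewrite -sumEFin.
apply: integrable_sum; first exact: measurable_Omega.
by move=> i _; exact: L1M.
Qed.

Lemma integral_dotE u G : L1v u -> Linfv G ->
  \int[mu]_(x in Om) dot (u x) (G x) =
  \sum_i \int[mu]_(x in Om) (u x ord0 i * G x ord0 i).
Proof. by move=> hu hG; rewrite Rintegral_Omega_sum // => i; exact: L1M. Qed.

Definition pairing u Phi : R := \int[mu]_(x in Om) dot (u x) (derive1 Phi x).

Hypothesis T0 : 0 < T.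

Lemma C1c_C1 Phi i : C1c T Phi -> C1 (coord i Phi).
Proof. by move=> /(C1cP _ _ T0)[]. Qed.

Lemma C1c_out Phi x : C1c T Phi -> ~ Om x -> Phi x = 0.
Proof.
move=> /(C1cP _ _ T0)[_ [a [b [a0 bT sPhi]]]] Ox;
  apply/eqP/negPn/negP => /sPhi /andP[ax xb].
by apply: Ox; rewrite /Omega /= in_itv /= (lt_le_trans a0 ax) (le_lt_trans xb bT).
Qed.

Lemma C1c_derive1 Phi x i : C1c T Phi ->
  derive1 Phi x ord0 i = derive1 (coord i Phi) x.
Proof. by case=> dPhi _ _ _; exact: derive1_coord. Qed.

Lemma Linfv_derive1 Phi : C1c T Phi -> Linfv (derive1 Phi).
Proof.
move=> CPhi i; under eq_fun do rewrite C1c_derive1 //.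
by apply: Linf_continuous; exact: (C1c_C1 _ i CPhi).2.
Qed.

Lemma pairing_L1 u Phi : L1v u -> C1c T Phi ->
  L1 T (fun x => dot (u x) (derive1 Phi x)).
Proof. by move=> hu CPhi; apply: L1_dot => //; exact: Linfv_derive1. Qed.

Lemma pairingDl u v Phi : L1v u -> L1v v -> C1c T Phi ->
  pairing (u + v) Phi = pairing u Phi + pairing v Phi.
Proof.
move=> hu hv CPhi; rewrite /pairing -RintegralD //; try exact: pairing_L1.
by apply: eq_Rintegral => x _; rewrite -dotDl.
Qed.

Lemma pairingZl (k : R) u Phi : L1v u -> C1c T Phi ->
  pairing (k *: u) Phi = k * pairing u Phi.
Proof.
move=> hu CPhi; rewrite /pairing -RintegralZl //; last exact: pairing_L1.
by apply: eq_Rintegral => x _; rewrite -dotZl.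
Qed.

Lemma C1cD Phi Psi : C1c T Phi -> C1c T Psi -> C1c T (Phi + Psi).
Proof.
move=> /(C1cP _ _ T0)[CPhi [a [b [a0 bT sPhi]]]]
  /(C1cP _ _ T0)[CPsi [c [d [c0 dT sPsi]]]].
apply/(C1cP _ _ T0); split=> [i|].
  rewrite (_ : coord i _ = fun x => coord i Phi x + coord i Psi x); first exact: C1D.
  by apply/funext => x; rewrite /coord mxE.
exists (Num.min a c), (Num.max b d); split; first by rewrite lt_min a0.
  by rewrite gt_max bT.
move=> x; rewrite ge_min le_max.
have [Px|/sPhi /andP[-> ->] //] := eqVneq (Phi x) 0.
have [Qx|/sPsi /andP[-> ->]] := eqVneq (Psi x) 0; last by rewrite !orbT.
by rewrite [X in X != 0](_ : _ = Phi x + Psi x) // Px Qx addr0 eqxx.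
Qed.

Lemma pairingDr u Phi Psi : L1v u -> C1c T Phi -> C1c T Psi ->
  pairing u (Phi + Psi) = pairing u Phi + pairing u Psi.
Proof.
move=> hu CPhi CPsi; rewrite /pairing -RintegralD //; try exact: pairing_L1.
apply: eq_Rintegral => x _; rewrite -dotDr; congr dot.
by case: CPhi CPsi => dPhi _ _ _ [dPsi _ _ _]; rewrite !derive1E deriveD.
Qed.

Lemma pairing_ae u v Phi : L1v u -> L1v v -> C1c T Phi ->
  (\forall x \ae mu, Om x -> u x = v x) -> pairing u Phi = pairing v Phi.
Proof.
move=> hu hv CPhi uv; rewrite /pairing /Rintegral; congr fine.
apply: ae_eq_integral => //; try exact: (measurable_int mu (pairing_L1 _ _ _ CPhi)).
by apply: (@filterS _ _ ae_lebesgue_filter _ _ _ uv) => x uvx Ox; rewrite uvx.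
Qed.

Lemma pairing_eq u v Phi : C1c T Phi ->
  (forall x, Om x -> derive1 Phi x <> 0 -> u x = v x) ->
  pairing u Phi = pairing v Phi.
Proof.
move=> CPhi uv; apply: eq_Rintegral => x /set_mem Ox.
have [->|/eqP P0] := eqVneq (derive1 Phi x) 0; first by rewrite !(dotC _ 0) !dot0l.
by rewrite uv.
Qed.

Lemma L1v_step (t : R) (b : vec) : L1v (step T t b).
Proof.
move=> i; apply: Linf_L1; rewrite (_ : (fun _ => _) =
  fun x => \1_(`]t, T[ : set R) x * b ord0 i); last by apply/funext => x; rewrite mxE.
apply: LinfM; last exact: Linf_cst.
split; first exact: measurable_indic.
by exists 1 => x _; rewrite indicE; case: (_ \in _); rewrite ?normr1 ?normr0 ?ler01.
Qed.

(** The fundamental theorem of calculus on ]t, T[; the boundary term at T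
    vanishes because Phi does. *)
Lemma pairing_step (t : R) (b : vec) Phi : 0 <= t <= T -> C1c T Phi ->
  pairing (step T t b) Phi = - dot b (Phi t).
Proof.
move=> /andP[t0 tT] CPhi.
have PT : Phi T = 0 by apply: C1c_out => //; rewrite /Omega /= in_itv /= ltxx andbF.
rewrite /pairing integral_dotE; [|exact: L1v_step|exact: Linfv_derive1].
rewrite -sumrN; apply: eq_bigr => i _.
rewrite (@eq_Rintegral _ _ _ mu _
  ((fun x => b ord0 i * derive1 (coord i Phi) x) \_ (`]t, T[ : set R))); last first.
  move=> x _; rewrite C1c_derive1 // mxE indicE patchE.
  by case: (x \in _); rewrite ?mul1r ?mul0r.
rewrite -Rintegral_mkcondr (_ : Om `&` _ = `]t, T[%classic); last first.
  apply/seteqP; split=> [x [] //|x /= xtT]; split => //.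
  by move: xtT; rewrite /Omega /= !in_itv /= => /andP[/(le_lt_trans t0) -> ->].
rewrite RintegralZl // ?integral_derive1 //;
  first by rewrite /coord PT mxE sub0r mulrN.
  exact: C1c_C1.
apply: (@integrableS _ _ _ mu Om) => //.
  by move=> x /=; rewrite /Omega /= !in_itv /= => /andP[/(le_lt_trans t0) -> ->].
by apply: Linf_L1; apply: Linf_continuous; exact: (C1c_C1 _ i CPhi).2.
Qed.

Lemma pairing_cst (c : vec) Phi : C1c T Phi -> pairing (fun=> c) Phi = 0.
Proof.
move=> CPhi; rewrite (_ : pairing _ _ = pairing (step T 0 c) Phi).
  rewrite pairing_step ?lexx ?ltW // C1c_out //; first by rewrite dotC dot0l oppr0.
  by rewrite /Omega /= in_itv /= ltxx.
by apply: eq_Rintegral => x xO; rewrite /step indicE [_ \in _]xO scale1r.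
Qed.

(** The bound on the dual norm is stated through its defining inequalities and
    at all points of the line, which is harmless since Phi vanishes outside
    the interval. *)
Definition admissible N Phi :=
  C1c T Phi /\ forall x b, N b <= 1 -> dot (Phi x) b <= 1.

Lemma TV_leP N u (c : R) : L1v u ->
  (TV T N u <= c%:E)%E <-> forall Phi, admissible N Phi -> pairing u Phi <= c.
Proof.
move=> hu.
have pE Phi : C1c T Phi ->
    (\int[mu]_(x in Om) (dot (u x) (derive1 Phi x))%:E)%E = (pairing u Phi)%:E.
  by move=> CPhi; rewrite /pairing /Rintegral fineK // integrable_fin_num //;
    exact: pairing_L1.
split=> [h Phi [CPhi aPhi]|h].
  rewrite -lee_fin -pE //; apply: le_trans h; apply: ereal_sup_ubound;
    exists Phi => //.
  by split=> // x _; apply/dual_norm_leP; exact: aPhi.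
apply: ge_ereal_sup => _ [Phi [CPhi aPhi] <-]; rewrite pE // lee_fin; apply: h.
split=> // x b Nb; have [Ox|Ox] := pselect (Om x);
  first exact: (dual_norm_leP _ _ _).1 (aPhi _ Ox) b Nb.
by rewrite C1c_out // dot0l ler01.
Qed.

Lemma admissible0 N : admissible N 0.
Proof.
split; last by move=> x b _; rewrite [X in dot X]/(0 x) /= dot0l ler01.
apply/(C1cP _ _ T0); split=> [i|].
  by rewrite (_ : coord i 0 = fun=> 0); [exact: C1_cst|apply/funext => x;
    rewrite /coord mxE].
by exists (T / 2), (T / 2); split=> [| |x];
  rewrite ?eqxx // ?divr_gt0 // gtr_pMr // invf_lt1 // ltr1n.
Qed.

Lemma TV_ge0 N u : (0 <= TV T N u)%E.
Proof.
apply: ereal_sup_ubound; exists 0; last first.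
  rewrite integral0_eq // => x _; rewrite (_ : derive1 0 x = 0) ?(dotC _ 0) ?dot0l //.
  by rewrite derive1_cst.
have [C0 a0] := admissible0 N; split=> // x _.
by apply/dual_norm_leP => b; exact: a0.
Qed.

End Pairing.

(** * Trapezoids *)

Section Trapezoid.
Context {R : realType}.
Implicit Types x y z r : R.

Definition trap x y r z : R := ramp x r z - ramp y r z.

Lemma trap_out x y r z : 0 < r -> x <= y -> z <= x \/ y + r <= z -> trap x y r z = 0.
Proof.
move=> r0 xy [zx|yz]; rewrite /trap.
  by rewrite !ramp_le ?subrr // (le_trans zx).
by rewrite !ramp_ge ?subrr // (le_trans _ yz) // lerD2r.
Qed.

Lemma trap_in x y r z : 0 < r -> x + r <= z <= y -> trap x y r z = 1.
Proof.
by move=> r0 /andP[xz zy]; rewrite /trap ramp_ge // ramp_le // subr0.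
Qed.

Lemma trap_itv x y r z : 0 < r -> x + r <= y -> 0 <= trap x y r z <= 1.
Proof.
move=> r0 xy; rewrite /trap.
have [zy|/ltW yz] := leP z y.
  by rewrite [ramp y r z]ramp_le // subr0 ramp_itv.
rewrite [ramp x r z]ramp_ge //; last exact: le_trans xy yz.
by have := ramp_itv y r z; lra.
Qed.

Lemma C1_trap x y r : 0 < r -> C1 (trap x y r).
Proof.
move=> r0; rewrite (_ : trap x y r = fun z => ramp x r z + (-1) * ramp y r z).
  by apply: C1D; [|apply: C1M; [exact: C1_cst|]]; exact: C1_ramp.
by apply/funext => z; rewrite mulN1r.
Qed.

Lemma derive1_trap x y r z : 0 < r ->
  derive1 (trap x y r) z = dramp x r z - dramp y r z.
Proof.
move=> r0; have [dx _] := C1_ramp x r r0; have [dy _] := C1_ramp y r r0.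
by rewrite derive1E deriveB // -!derive1E !derive1_ramp.
Qed.

End Trapezoid.

(** * Lebesgue points *)

Section LebesguePoints.
Context {R : realType} {n : nat} (T : R).
Local Notation mu := (@lebesgue_measure R).
Local Notation Om := (Omega T).
Local Notation vec := 'rV[R]_n.
Implicit Types (u v G Phi Psi : R -> vec) (N : vec -> R) (p : vec).

Let mOm : measurable (Om : set R) := measurable_Omega T.
Local Hint Resolve mOm : core.

Hypothesis T0 : 0 < T.

Lemma derive1Z (f : R -> R) p x : C1 f ->
  derive1 (fun z => f z *: p) x = derive1 f x *: p.
Proof.
move=> Cf; apply/rowP => i.
have dP : derivable (fun z => f z *: p) x 1.
  apply/derivable_mxP => k j; rewrite ord1.
  by have := C1M f (fun=> p ord0 j) Cf (C1_cst _); rewrite -coordZ => -[].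
rewrite derive1_coord // coordZ (derive1M_C1 _ _ Cf (C1_cst _)) mxE.
by rewrite derive1_cst mulr0 add0r mulrC.
Qed.

Lemma C1cZ (f : R -> R) p (a b : R) : C1 f -> 0 < a -> b < T ->
  (forall x, x < a \/ b < x -> f x = 0) -> C1c T (fun z => f z *: p).
Proof.
move=> Cf a0 bT f0; apply/(C1cP _ _ T0); split=> [i|].
  by rewrite coordZ; apply: C1M => //; exact: C1_cst.
exists a, b; split=> // x fx; rewrite !leNgt -negb_or; apply: contra_neqN fx.
by move=> /orP /f0 ->; rewrite scale0r.
Qed.

Lemma admissible_trap N p x y r : 0 < x -> 0 < r -> x + r <= y -> y + r < T ->
  (forall b, N b <= 1 -> dot p b <= 1) ->
  admissible T N (fun z => trap x y r z *: p).
Proof.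
move=> x0 r0 xry yT pN; split.
  apply: (@C1cZ _ _ x (y + r)) => //; first exact: C1_trap.
  move=> z xz; apply: trap_out => //; first by apply: le_trans xry; rewrite lerDl ltW.
  by case: xz => /ltW; [left|right].
move=> z b /pN pb; rewrite dotZl.
have /andP[t0 t1] := trap_itv x y r z r0 xry.
by apply: le_trans t1; rewrite -[leRHS]mulr1 ler_wpM2l.
Qed.

Definition leb_pt u (s : R) := forall i, lebesgue_pt ((fun x => u x ord0 i) \_ Om) s.

Lemma ae_leb_pt u : L1v T u -> \forall s \ae mu, leb_pt u s.
Proof.
move=> hu; have F := @ae_lebesgue_filter R.
apply: (@filter_forall _ _ (fun i s => lebesgue_pt ((fun x => u x ord0 i) \_ Om)
  s)) => i.
apply: lebesgue_differentiation; apply: open_integrable_locally; first exact: openT.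
rewrite -restrict_EFin; apply/integrable_restrict => //.
by rewrite setTI; exact: hu.
Qed.

Lemma Linfv_bound G : Linfv T G ->
  exists2 B : R, 0 <= B & forall i x, Om x -> `|G x ord0 i| <= B.
Proof.
move=> hG; have [M MG] := choice (fun i => (hG i).2).
exists (\sum_i `|M i|) => [|i x Ox]; first exact: sumr_ge0.
rewrite (bigD1 i) //= (le_trans (MG i x Ox)) // (le_trans (ler_norm _)) // lerDl.
exact: sumr_ge0.
Qed.

Lemma leb_pt_kernel u (s M e : R) : L1v T u -> Om s -> leb_pt u s ->
  0 < M -> 0 < e ->
  \forall r \near 0^'+, forall G,
    (forall i, measurable_fun Om (fun x => G x ord0 i)) ->
    (forall i x, Om x -> `|G x ord0 i| <= M / r) ->
    (forall x, Om x -> r <= `|x - s| -> G x = 0) ->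
    `|\int[mu]_(x in Om) dot (u x - u s) (G x)| <= e.
Proof.
move=> hu Os leb M0 e0.
have e'0 : 0 < e / n.+1%:R by rewrite divr_gt0.
have H : \forall r \near 0^'+, forall i, forall g : R -> R, measurable_fun Om g ->
    (forall x, Om x -> `|g x| <= M / r) ->
    (forall x, Om x -> r <= `|x - s| -> g x = 0) ->
    `|\int[mu]_(x in Om) ((u x ord0 i - u s ord0 i) * g x)| <= e / n.+1%:R.
  by apply: filter_forall => i; apply: lebesgue_pt_kernel (hu i) Os (leb i) M0 e'0.
near=> r => G mG GM Gs.
have Hr : forall i, forall g : R -> R, measurable_fun Om g ->
    (forall x, Om x -> `|g x| <= M / r) ->
    (forall x, Om x -> r <= `|x - s| -> g x = 0) ->
    `|\int[mu]_(x in Om) ((u x ord0 i - u s ord0 i) * g x)| <= e / n.+1%:R.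
  by near: r.
have hG : Linfv T G by move=> i; split => //; exists (M / r); exact: GM.
have hw : L1v T (fun x => u x - u s) := L1vD _ _ _ hu (L1v_cst _ (- u s)).
rewrite (integral_dotE _ _ _ hw hG); apply: le_trans (ler_norm_sum _ _ _) _.
apply: (@le_trans _ _ (\sum_(i < n) e / n.+1%:R)).
  apply: ler_sum => i _; under eq_Rintegral do rewrite mxE [X in _ + X]mxE.
  by apply: Hr => // [|x Ox rx]; [exact: GM|rewrite Gs // mxE].
rewrite sumr_const card_ord -[leRHS](@divfK _ n.+1%:R) ?pnatr_eq0 //.
by rewrite mulr_natr ler_wpMn2l // ltW.
Unshelve. all: by end_near. Qed.

(** The derivative of the ramp is a nonnegative kernel of mass 1 on
    [s, s + r], so its integral against u tends to u s. *)
Lemma leb_pt_average u (s : R) p e : L1v T u -> Om s -> leb_pt u s -> 0 < e ->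
  \forall r \near 0^'+,
    `|\int[mu]_(x in Om) dot (u x) (dramp s r x *: p) - dot (u s) p| <= e.
Proof.
move=> hu Os leb e0.
have [B B0 pB] : exists2 B : R, 0 <= B & forall i x, Om x -> `|p ord0 i| <= B.
  by apply: (@Linfv_bound (fun=> p)) => i; exact: Linf_cst.
have M0 : 0 < 2 * (B + 1) by rewrite mulr_gt0 // ltr_wpDl.
have ker := leb_pt_kernel u s _ e hu Os leb M0 e0.
move: (Os); rewrite /Omega /= in_itv /= => /andP[s0 sT].
near=> r.
have r0 : 0 < r by near: r; exact: nbhs_right_gt.
have rT : r < T - s by near: r; apply: nbhs_right_lt; rewrite subr_gt0.
have hG : Linfv T (fun x => dramp s r x *: p).
  move=> i; under eq_fun do rewrite mxE; apply: LinfM; last exact: Linf_cst.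
  by apply: Linf_continuous; exact: dramp_continuous.
have -> : dot (u s) p = \int[mu]_(x in Om) dot (u s) (dramp s r x *: p).
  under eq_Rintegral do rewrite dotZr mulrC.
  rewrite RintegralZl //; last first.
    by apply: Linf_L1; apply: Linf_continuous; exact: dramp_continuous.
  rewrite -derive1_ramp // integral_derive1 ?ltW //; last exact: C1_ramp.
  rewrite ramp_ge // ?ramp_le // ?ltW //; first by rewrite subr0 mulr1.
  by rewrite -ltrBrDl.
rewrite -RintegralB //; try exact: L1_dot.
  under eq_Rintegral do rewrite -dotNl -dotDl.
  have : forall G, (forall i, measurable_fun Om (fun x => G x ord0 i)) ->
    (forall i x, Om x -> `|G x ord0 i| <= 2 * (B + 1) / r) ->
    (forall x, Om x -> r <= `|x - s| -> G x = 0) ->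
    `|\int[mu]_(x in Om) dot (u x - u s) (G x)| <= e by near: r.
  apply=> [i|i x Ox|x Ox rx]; first exact: (hG i).1.
    rewrite mxE normrM mulrAC ler_pM //; first exact: dramp_le.
    by rewrite (le_trans (pB i x Ox)) // lerDl.
  rewrite dramp_out ?scale0r //; move: rx; rewrite ler_normr.
  by move=> /orP[] h; [right|left]; lra.
by apply: L1_dot => //; exact: L1v_cst.
Unshelve. all: by end_near. Qed.

(** A du Bois-Reymond lemma. Test with a trapezoid that rises after x and falls
    after y, multiplied by a functional p supporting N at u x - u y: the
    integral tends to dot p (u x - u y) = N (u x - u y), which is thus at
    most 0. *)
Lemma leb_pt_const N u (a b x y : R) : is_norm N -> L1v T u -> 0 <= a -> b <= T ->
  (forall Phi a' b', admissible T N Phi -> a < a' -> b' < b ->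
     supported_in Phi a' b' -> pairing T u Phi <= 0) ->
  a < x < b -> a < y < b -> leb_pt u x -> leb_pt u y -> u x = u y.
Proof.
move=> hN hu a0 bT H; wlog xy : x y / x < y.
  move=> W xab yab lx ly; have [xy|yx|->//] := ltgtP x y; first exact: W.
  by apply/esym; exact: W.
move=> /andP[ax xb] /andP[ay yb] lx ly.
have Ox : Om x by rewrite /Omega /= in_itv /= (le_lt_trans a0 ax) (lt_le_trans xb bT).
have Oy : Om y by rewrite /Omega /= in_itv /= (le_lt_trans a0 ay) (lt_le_trans yb bT).
apply/eqP; rewrite -subr_eq0; apply/eqP; apply: (is_norm_eq0 hN).
apply/eqP; rewrite eq_le is_norm_ge0 // andbT.
have [p [pN pK]] := support_functional _ N (u x - u y) (is_norm_sublinear _ _ hN).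
rewrite -pN; apply/ler_addgt0Pr => e e0; rewrite add0r.
have e20 : 0 < e / 2 by rewrite divr_gt0.
have avx := leb_pt_average u x p (e / 2) hu Ox lx e20.
have avy := leb_pt_average u y p (e / 2) hu Oy ly e20.
near ((0 : R)^'+) => r.
have r0 : 0 < r by near: r; exact: nbhs_right_gt.
have rxy : r < y - x by near: r; apply: nbhs_right_lt; rewrite subr_gt0.
have ryb : r < b - y by near: r; apply: nbhs_right_lt; rewrite subr_gt0.
have xry : x + r <= y by lra.
have aPhi : admissible T N (fun z => trap x y r z *: p).
  apply: admissible_trap => //; [exact: le_lt_trans ax|lra|].
  by move=> c Nc; exact: le_trans (pK c) Nc.
have : pairing T u (fun z => trap x y r z *: p) <= 0.
  apply: (H _ ((a + x) / 2) ((y + r + b) / 2) aPhi); [lra|lra|].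
  move=> z; apply: contra_neqT; rewrite negb_and -!ltNge => /orP h.
  rewrite trap_out ?scale0r //; first lra.
  by case: h => h; [left|right]; lra.
rewrite /pairing (@eq_Rintegral _ _ _ mu _ (fun z => dot (u z) (dramp x r z *: p) -
    dot (u z) (dramp y r z *: p))); last first.
  move=> z _; rewrite derive1Z; last exact: C1_trap.
  by rewrite derive1_trap // !dotZr mulrBl.
have hG s : Linfv T (fun x => dramp s r x *: p).
  move=> i; under eq_fun do rewrite mxE; apply: LinfM; last exact: Linf_cst.
  by apply: Linf_continuous; exact: dramp_continuous.
rewrite RintegralB //; try exact: L1_dot.
have hx : `|\int[mu]_(z in Om) dot (u z) (dramp x r z *: p) - dot (u x) p| <= e / 2.
  by near: r.
have hy : `|\int[mu]_(z in Om) dot (u z) (dramp y r z *: p) - dot (u y) p| <= e / 2.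
  by near: r.
move: hx hy; rewrite !ler_norml dotDr dotNr (dotC p) (dotC p); lra.
Unshelve. all: by end_near. Qed.

End LebesguePoints.

(** * Cutting at a Lebesgue point *)

Section Glue.
Context {R : realType} {n : nat} (T : R).
Local Notation mu := (@lebesgue_measure R).
Local Notation Om := (Omega T).
Local Notation vec := 'rV[R]_n.
Implicit Types (u v G Phi Psi : R -> vec) (N : vec -> R) (p : vec).

Let mOm : measurable (Om : set R) := measurable_Omega T.
Local Hint Resolve mOm : core.

Hypothesis T0 : 0 < T.

Lemma LinfvD u v : Linfv T u -> Linfv T v -> Linfv T (fun x => u x + v x).
Proof. by move=> hu hv i; under eq_fun do rewrite mxE; exact: LinfD. Qed.

Lemma Linfv_mul (g : R -> R) u : Linf T g -> Linfv T u -> Linfv T (fun x => g x *: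
  u x).
Proof. by move=> hg hu i; under eq_fun do rewrite mxE; exact: LinfM. Qed.

Lemma Linfv_C1c Phi : C1c T Phi -> Linfv T Phi.
Proof.
by move=> CPhi i; apply: Linf_continuous; apply: C1_continuous;
  exact: (C1c_C1 T T0 Phi i).
Qed.

Lemma C1cM (f : R -> R) Phi : C1 f -> C1c T Phi -> C1c T (fun x => f x *: Phi x).
Proof.
move=> Cf /(C1cP _ _ T0)[CPhi [a [b [a0 bT sPhi]]]]; apply/(C1cP _ _ T0);
  split=> [i|].
  rewrite (_ : coord i _ = fun x => f x * coord i Phi x); first exact: C1M.
  by apply/funext => x; rewrite /coord mxE.
exists a, b; split=> // x fx; apply: sPhi.
by apply: contra_neq fx => ->; rewrite scaler0.
Qed.

Lemma derive1_C1cM (f : R -> R) Phi x : C1 f -> C1c T Phi ->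
  derive1 (fun x => f x *: Phi x) x = f x *: derive1 Phi x + derive1 f x *: Phi x.
Proof.
move=> Cf CPhi; apply/rowP => i;
  rewrite !mxE (C1c_derive1 T _ _ _ (C1cM _ _ Cf CPhi)).
rewrite (_ : coord i _ = fun x => f x * coord i Phi x); last first.
  by apply/funext => y; rewrite /coord mxE.
rewrite (derive1M_C1 _ _ Cf (C1c_C1 T T0 _ i CPhi)) (C1c_derive1 T _ _ _ CPhi).
by rewrite [X in _ + X]mulrC.
Qed.

Definition cut_left (s : R) u (x : R) : vec := (x < s)%R%:R *: (u x - u s).
Definition cut_right (s : R) u (x : R) : vec := (1 - (x < s)%R%:R) *: (u x - u s).

Lemma Linf_ge (s : R) : Linf T (fun x => 1 - (x < s)%R%:R).
Proof.
rewrite (_ : (fun _ => _) = fun x => 1 + (-1) * (x < s)%R%:R).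
  by apply: LinfD; [|apply: LinfM; [|exact: Linf_lt]]; exact: Linf_cst.
by apply/funext => x; rewrite mulN1r.
Qed.

Lemma L1v_subc u (c : vec) : L1v T u -> L1v T (fun x => u x - c).
Proof. by move=> hu; exact: (L1vD _ _ _ hu (L1v_cst _ (- c))). Qed.

Lemma L1v_cut_left s u : L1v T u -> L1v T (cut_left s u).
Proof. by move=> hu; apply: L1v_mul; [exact: L1v_subc|exact: Linf_lt]. Qed.

Lemma L1v_cut_right s u : L1v T u -> L1v T (cut_right s u).
Proof. by move=> hu; apply: L1v_mul; [exact: L1v_subc|exact: Linf_ge]. Qed.

Lemma combination_entry (a b : R) (v w : vec) i :
  (a *: v + b *: w) ord0 i = a * v ord0 i + b * w ord0 i.
Proof. by rewrite !mxE. Qed.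

(** The error made by a cutoff of width r: a term with a factor bounded by 1
    and a term with a derivative bounded by 2 / r. *)
Lemma le_cutoff_error (r a b c d A B M : R) : 0 < r -> r < 1 ->
  `|a| <= 1 -> `|b| <= 2 / r -> `|c| <= B -> `|d| <= A -> 2 * A + B <= M ->
  `|a * c + b * d| <= M / r.
Proof.
move=> r0 r1 ha hb hc hd hM.
have A0 : 0 <= A := le_trans (normr_ge0 _) hd.
have B0 : 0 <= B := le_trans (normr_ge0 _) hc.
apply: le_trans (ler_normD _ _) _; rewrite !normrM.
have i1 : `|a| * `|c| <= 1 * B by apply: ler_pM.
have i2 : `|b| * `|d| <= 2 / r * A by apply: ler_pM.
have i3 : (2 * A + B) / r <= M / r by rewrite ler_pM2r // invr_gt0.
have i4 : B <= B / r by rewrite ler_pdivlMr // ler_piMr // ltW.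
apply: le_trans i3; apply: le_trans (lerD i1 i2) _.
by rewrite mul1r (_ : (2 * A + B) / r = B / r + 2 / r * A) ?lerD2r //; ring.
Qed.

(** Glue Phi1 before s to Phi2 after s with two cutoffs that vanish at s. The
    two cutoffs never overlap, so the result is admissible. The error is
    supported in a ball of radius r around s and is of size O(1/r), hence it
    contributes little at a Lebesgue point. *)
Lemma glue_admissible N u (s e : R) Phi1 Phi2 : L1v T u -> Om s -> leb_pt T u s ->
  admissible T N Phi1 -> admissible T N Phi2 -> 0 < e ->
  exists2 Phi, admissible T N Phi &
    pairing T (cut_left s u) Phi1 + pairing T (cut_right s u) Phi2 <=
      pairing T u Phi + e.
Proof.
move=> hu Os leb [CPhi1 a1] [CPhi2 a2] e0.
have [A1 A10 A1B] := Linfv_bound T _ (Linfv_C1c _ CPhi1).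
have [A2 A20 A2B] := Linfv_bound T _ (Linfv_C1c _ CPhi2).
have [B1 B10 B1B] := Linfv_bound T _ (Linfv_derive1 T T0 _ CPhi1).
have [B2 B20 B2B] := Linfv_bound T _ (Linfv_derive1 T T0 _ CPhi2).
have [M [M0 M1 M2]] : exists M : R, [/\ 0 < M, 2 * A1 + B1 <= M & 2 * A2 + B2 <= M].
  by exists (2 * A1 + 2 * A2 + B1 + B2 + 1); split; lra.
have ker := leb_pt_kernel T u s M e hu Os leb M0 e0.
near ((0 : R)^'+) => r.
have r0 : 0 < r by near: r; exact: nbhs_right_gt.
have r1 : r < 1 by near: r; apply: nbhs_right_lt.
pose chi x := 1 + (-1) * ramp (s - r) r x.
pose psi := ramp s r.
have Cpsi : C1 psi := C1_ramp s r r0.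
have Cramp : C1 (ramp (s - r) r) := C1_ramp _ r r0.
have Cneg := C1M _ _ (C1_cst (-1)) Cramp.
have Cchi : C1 chi := C1D _ _ (C1_cst 1) Cneg.
have dchi x : derive1 chi x = - dramp (s - r) r x.
  rewrite (derive1D_C1 _ _ (C1_cst 1) Cneg) (derive1M_C1 _ _ (C1_cst _) Cramp).
  by rewrite !derive1_cst derive1_ramp // mulr0 addr0 add0r mulN1r.
have chi_l x : x <= s - r -> chi x = 1.
  by move=> xs; rewrite /chi ramp_le // mulr0 addr0.
have chi_r x : s <= x -> chi x = 0.
  by move=> sx; rewrite /chi ramp_ge ?subrK // mulr1 subrr.
have chi01 x : 0 <= chi x <= 1 by rewrite /chi; have := ramp_itv (s - r) r x; lra.
(* chi is 1 up to s - r and vanishes from s on; psi vanishes up to s. *)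
pose Phi := (fun x => chi x *: Phi1 x) + (fun x => psi x *: Phi2 x).
have CcPhi1 := C1cM _ _ Cchi CPhi1.
have CcPhi2 := C1cM _ _ Cpsi CPhi2.
have CPhi : C1c T Phi by exact: C1cD.
have le1 (k y : R) : 0 <= k <= 1 -> y <= 1 -> k * y <= 1 by nra.
exists Phi.
  split=> // x b Nb; have -> : Phi x = chi x *: Phi1 x + psi x *: Phi2 x by [].
  have [xs|sx] := leP x s.
    by rewrite [psi x]ramp_le // scale0r addr0 dotZl le1 // a1.
  by rewrite (chi_r x (ltW sx)) scale0r add0r dotZl le1 ?ramp_itv // a2.
have dPhi x : derive1 Phi x =
    chi x *: derive1 Phi1 x + - dramp (s - r) r x *: Phi1 x +
    (psi x *: derive1 Phi2 x + dramp s r x *: Phi2 x).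
  rewrite -dchi -(derive1_ramp s r r0) -!derive1_C1cM //.
  by case: CcPhi1 CcPhi2 => d1 _ _ _ [d2 _ _ _]; rewrite !derive1E deriveD.
pose l x : R := (x < s)%R%:R.
pose G x := derive1 Phi x + (- l x *: derive1 Phi1 x + - (1 - l x) *: derive1 Phi2 x).
have Gl x : x < s -> G x =
    - ramp (s - r) r x *: derive1 Phi1 x + - dramp (s - r) r x *: Phi1 x.
  move=> xs; rewrite /G dPhi /l xs subrr oppr0 scale0r addr0.
  rewrite [psi x](ramp_le s r x r0 (ltW xs)) (dramp_out s r x r0 (or_introl (ltW
    xs))).
  rewrite !scale0r !addr0 addrAC -scalerDl; congr (_ *: _ + _).
  by rewrite /chi /=; ring.
have Gr x : s <= x -> G x = (ramp s r x - 1) *: derive1 Phi2 x + dramp s r x *: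
  Phi2 x.
  move=> sx; rewrite /G dPhi /l ltNge sx /= subr0 oppr0 scale0r add0r chi_r //.
  rewrite dramp_out //; last by right; rewrite subrK.
  by rewrite oppr0 !scale0r !add0r addrAC -scalerDl.
have hl : Linf T (fun x => - l x).
  rewrite (_ : (fun _ => _) = fun x => (-1) * l x).
    by apply: LinfM; [exact: Linf_cst|exact: Linf_lt].
  by apply/funext => x; rewrite mulN1r.
have hr : Linf T (fun x => - (1 - l x)).
  rewrite (_ : (fun _ => _) = fun x => (-1) * (1 - l x)).
    by apply: LinfM; [exact: Linf_cst|exact: Linf_ge].
  by apply/funext => x; rewrite mulN1r.
have h1 := Linfv_derive1 T T0 _ CPhi1.
have h2 := Linfv_derive1 T T0 _ CPhi2.
have h0 := Linfv_derive1 T T0 _ CPhi.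
have h3 : Linfv T (fun x => - l x *: derive1 Phi1 x + - (1 - l x) *: derive1 Phi2 x).
  by apply: LinfvD; exact: Linfv_mul.
have hG : Linfv T G by exact: LinfvD.
have hw := L1v_subc u (u s) hu.
have wG : \int[mu]_(x in Om) dot (u x - u s) (G x) = pairing T u Phi -
    (pairing T (cut_left s u) Phi1 + pairing T (cut_right s u) Phi2).
  have -> : pairing T u Phi = pairing T (fun x => u x - u s) Phi.
    by rewrite [RHS](pairingDl _ T0 u (fun=> - u s)) ?pairing_cst ?addr0 //;
      exact: L1v_cst.
  have Ll := pairing_L1 T T0 _ _ (L1v_cut_left s u hu) CPhi1.
  have Lr := pairing_L1 T T0 _ _ (L1v_cut_right s u hu) CPhi2.
  have Lw := pairing_L1 T T0 _ _ hw CPhi.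
  have E1 := Rintegral_OmegaB T _ _ Lw (L1D T _ _ Ll Lr).
  have E2 := Rintegral_OmegaD T _ _ Ll Lr.
  rewrite E2 in E1; rewrite /pairing -E1.
  apply: eq_Rintegral => x _.
  rewrite /G !dotDr !dotZr !dotZl -/(l x).
  by move: (dot _ _) (dot _ (derive1 Phi1 x)) (dot _ (derive1 Phi2 x)) (l x) => *;
    ring.
have : `|\int[mu]_(x in Om) dot (u x - u s) (G x)| <= e.
  have kerr : forall G, (forall i, measurable_fun Om (fun x => G x ord0 i)) ->
    (forall i x, Om x -> `|G x ord0 i| <= M / r) ->
    (forall x, Om x -> r <= `|x - s| -> G x = 0) ->
    `|\int[mu]_(x in Om) dot (u x - u s) (G x)| <= e by near: r.
  apply: kerr => [i|i x Ox|x Ox rx]; first exact: (hG i).1.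
    have [xs|sx] := ltP x s.
      rewrite Gl // combination_entry.
      have ra : `|- ramp (s - r) r x| <= 1.
        by have /andP[t0 t1] := ramp_itv (s - r) r x; rewrite normrN ger0_norm.
      have rb : `|- dramp (s - r) r x| <= 2 / r by rewrite normrN; exact: dramp_le.
      exact: le_cutoff_error r0 r1 ra rb (B1B i x Ox) (A1B i x Ox) M1.
    rewrite Gr // combination_entry.
    have ra : `|ramp s r x - 1| <= 1.
      have /andP[t0 t1] := ramp_itv s r x.
      by rewrite distrC ger0_norm ?subr_ge0 // gerBl.
    have rb := dramp_le s r x r0.
    exact: le_cutoff_error r0 r1 ra rb (B2B i x Ox) (A2B i x Ox) M2.
  have [xs|sx] := ltP x s.
    move: rx; rewrite ltr0_norm ?subr_lt0 // opprB lerBrDl -lerBrDr => xsr.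
    by rewrite (Gl _ xs) (ramp_le _ _ _ r0 xsr) (dramp_out _ _ _ r0 (or_introl
      xsr)) oppr0 !scale0r addr0.
  move: rx; rewrite ger0_norm ?subr_ge0 // lerBrDl => xsr.
  by rewrite (Gr _ sx) (ramp_ge _ _ _ r0 xsr) (dramp_out _ _ _ r0 (or_intror xsr))
    subrr !scale0r addr0.
by rewrite wG ler_norml lerBrDl lerBlDr => /andP[].
Unshelve. all: by end_near. Qed.

Lemma pairing_cut_le N u (s c : R) Phi1 Phi2 : L1v T u -> Om s -> leb_pt T u s ->
  (TV T N u <= c%:E)%E -> admissible T N Phi1 -> admissible T N Phi2 ->
  pairing T (cut_left s u) Phi1 + pairing T (cut_right s u) Phi2 <= c.
Proof.
move=> hu Os leb uc a1 a2; apply/ler_addgt0Pr => e e0.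
have [Phi aPhi h] := glue_admissible N u s e Phi1 Phi2 hu Os leb a1 a2 e0.
by apply: le_trans h _; rewrite lerD2r; exact: (TV_leP T T0 N u c hu).1 uc Phi aPhi.
Qed.

(** The total variation is superadditive when the interval is cut at a Lebesgue
    point: the supremum over Phi1 and Phi2 in [pairing_cut_le] may be taken
    separately. *)
Lemma TV_cut N u (s c : R) : L1v T u -> Om s -> leb_pt T u s ->
  (TV T N u <= c%:E)%E ->
  exists2 v, 0 <= v <= c & (TV T N (cut_left s u) <= v%:E)%E /\
    (TV T N (cut_right s u) <= (c - v)%:E)%E.
Proof.
move=> hu Os leb uc.
have hl := L1v_cut_left s u hu; have hr := L1v_cut_right s u hu.
have key := pairing_cut_le N u s c _ _ hu Os leb uc.
have P0 (w : R -> vec) : L1v T w -> pairing T w 0 = 0.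
  move=> hw; have := pairingDr T T0 w 0 0 hw (admissible0 T T0 N).1 (admissible0 T
    T0 N).1.
  by rewrite addr0 => /esym/eqP; rewrite -subr_eq0 addrK => /eqP.
have lc : (TV T N (cut_left s u) <= c%:E)%E.
  apply/(TV_leP T T0) => // Phi1 a1.
  by have := key Phi1 0 a1 (admissible0 T T0 N); rewrite P0 // addr0.
have l0 := TV_ge0 T T0 N (cut_left s u).
move: lc l0 (TV_leP T T0 N (cut_left s u));
  case: (TV T N (cut_left s u)) => [v| |] //.
rewrite !lee_fin => vc v0 vP; exists v; first by rewrite v0.
split=> //; apply/(TV_leP T T0) => // Phi2 a2.
rewrite lerBrDl -lerBrDr -lee_fin; apply/vP => // Phi1 a1.
by rewrite lerBrDr; exact: key.
Qed.

End Glue.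

(** * Step functions *)

Section Steps.
Context {R : realType} {n : nat} (T : R).
Local Notation mu := (@lebesgue_measure R).
Local Notation Om := (Omega T).
Local Notation vec := 'rV[R]_n.
Implicit Types (u v G Phi Psi : R -> vec) (N : vec -> R) (a b c p : vec).

Hypothesis T0 : 0 < T.

Lemma ae_itv_ex (x y : R) (P : R -> Prop) : x < y ->
  (\forall z \ae mu, P z) -> exists2 z, x < z < y & P z.
Proof.
move=> xy aeP; apply: contrapT => noz.
have : mu.-negligible (`]x, y[ : set R).
  apply: negligibleS aeP => z /=; rewrite in_itv /= => xzy Pz.
  by apply: noz; exists z.
move/negligibleP => /(_ (measurable_itv _)).
rewrite /= lebesgue_measure_itv /= lte_fin xy => /eqP.
by rewrite -EFinB eqe subr_eq0 gt_eqF.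
Qed.

Lemma ae_neq (t : R) : \forall x \ae mu, x <> t.
Proof.
exists [set t]; split; [exact: measurable_set1|exact: lebesgue_measure_set1|].
by move=> x /= /contrapT.
Qed.

Lemma step_l (t x : R) b : x <= t -> step T t b x = 0.
Proof.
move=> xt; rewrite /step indicE [_ \in _](_ : _ = false) ?scale0r //.
by apply/negbTE; rewrite notin_setE /= in_itv /= => /andP[]; rewrite ltNge xt.
Qed.

Lemma step_r (t x : R) b : t < x < T -> step T t b x = b.
Proof. by move=> tx; rewrite /step indicE mem_set ?scale1r //= in_itv. Qed.

Lemma stepD (t : R) b c : step T t (b + c) = step T t b + step T t c.
Proof. by apply/funext => x; rewrite /step scalerDr. Qed.

Lemma stepZ (t k : R) b : step T t (k *: b) = k *: step T t b.
Proof. by apply/funext => x; rewrite /step scalerA mulrC -scalerA. Qed.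

Lemma cls_two_constants u (t : R) a b :
  (\forall x \ae mu, 0 < x < t -> u x = a) ->
  (\forall x \ae mu, t < x < T -> u x = b) ->
  cls T u = cls T (step T t (b - a)).
Proof.
move=> ha hb; apply/clsP; exists a.
have F := @ae_lebesgue_filter R.
apply: (filterS3 _ _ ha hb (ae_neq t)) => x xa xb xt.
rewrite /Omega /= in_itv /= => /andP[x0 xT].
have [xlt|tx|//] := ltgtP x t.
  by rewrite step_l ?ltW // add0r xa // x0.
by rewrite step_r ?tx // subrK xb // tx.
Qed.

Lemma step_inj (t : R) b c : 0 < t < T ->
  cls T (step T t b) = cls T (step T t c) -> b = c.
Proof.
move=> /andP[t0 tT] /clsP[a ha].
have [x /andP[x0 xt] hx] := ae_itv_ex 0 t _ t0 ha.
have [y /andP[ty yT] hy] := ae_itv_ex t T _ tT ha.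
have a0 : a = 0.
  move: hx; rewrite !step_l ?ltW // add0r => -> //.
  by rewrite /Omega /= in_itv /= x0 (lt_trans xt).
move: hy; rewrite !step_r ?ty // a0 addr0; apply.
by rewrite /Omega /= in_itv /= yT (lt_trans t0).
Qed.

Lemma pairing_cls u v Phi : L1v T u -> L1v T v -> C1c T Phi ->
  cls T u = cls T v -> pairing T u Phi = pairing T v Phi.
Proof.
move=> hu hv CPhi /clsP[a ha].
have hc : L1v T (fun=> a) by exact: L1v_cst.
have hva : L1v T (v + (fun=> a)) by exact: L1vD.
rewrite (pairing_ae _ T0 _ (v + (fun=> a))) //.
by rewrite pairingDl // pairing_cst // addr0.
Qed.

(** Applied to the given norm, and to the Euclidean one to see that steps are
    in BV. The bound is dot (Phi t) (- b) <= N (- b), by duality. *)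
Lemma TV_step N (t : R) b : 0 <= t <= T ->
  (forall a, 0 <= N a) -> (forall (k : R) a, N (k *: a) = `|k| * N a) ->
  (forall a, N a = 0 -> a = 0) ->
  (TV T N (step T t b) <= (N b)%:E)%E.
Proof.
move=> tT N0 NZ Neq0; apply/(TV_leP T T0); first exact: L1v_step.
move=> Phi [CPhi aPhi]; rewrite pairing_step //.
have [Nb|Nb] := eqVneq (N b) 0; first by rewrite (Neq0 _ Nb) dot0l oppr0.
have Nb0 : 0 < N b by rewrite lt_def Nb N0.
have : dot (Phi t) ((- (N b)^-1) *: b) <= 1.
  by apply: aPhi; rewrite NZ normrN ger0_norm ?invr_ge0 // mulVf.
by rewrite dotZr mulNr dotC -mulrN ler_pdivrMl // mulr1.
Qed.

Lemma BV_step (t : R) b : 0 <= t <= T -> BV T (step T t b).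
Proof.
move=> tT; split; first exact: L1v_step.
have dge0 a : 0 <= dot a a by apply: sumr_ge0 => i _; rewrite -expr2 sqr_ge0.
apply: le_lt_trans (TV_step (@euclid R n) t b tT _ _ _) (ltry _).
- by move=> a; exact: sqrtr_ge0.
- move=> k a; rewrite /euclid dotZl dotZr mulrA -expr2 sqrtrM ?sqr_ge0 //.
  by rewrite sqrtr_sqr.
- move=> a /eqP; rewrite sqrtr_eq0 => a0.
  have {}a0 : dot a a == 0 by rewrite eq_le a0 dge0.
  move: a0; rewrite psumr_eq0; last by move=> i _; rewrite -expr2 sqr_ge0.
  move=> /allP a0; apply/rowP => i; rewrite mxE; apply/eqP.
  by have := a0 i (mem_index_enum _); rewrite /= mulf_eq0 orbb.
Qed.

Lemma step_in_ball N (t : R) b : is_norm N -> 0 <= t <= T -> N b <= 1 ->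
  TV_ball T N (cls T (step T t b)).
Proof.
move=> hN tT Nb; exists (step T t b) => //; split; first exact: BV_step.
apply: le_trans (TV_step N t b tT _ (is_norm_homog hN) (is_norm_eq0 hN)) _.
  by move=> a; exact: is_norm_ge0.
by rewrite lee_fin.
Qed.

Lemma bump_admissible N (t d : R) p : 0 < t < T -> 0 < d ->
  (forall c, N c <= 1 -> dot p c <= 1) ->
  exists2 Psi, admissible T N Psi &
    Psi t = p /\ forall x, d <= `|x - t| -> Psi x = 0.
Proof.
move=> /andP[t0 tT] d0 pN.
near ((0 : R)^'+) => r.
have r0 : 0 < r by near: r; exact: nbhs_right_gt.
have rt : r < t by near: r; exact: nbhs_right_lt.
have rT : r < T - t by near: r; apply: nbhs_right_lt; rewrite subr_gt0.
have rd : r < d by near: r; exact: nbhs_right_lt.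
(* This trapezoid takes the value 1 only at t. *)
exists (fun z => trap (t - r) t r z *: p).
  by apply: admissible_trap => //; lra.
split=> [|x xt]; first by rewrite trap_in ?scale1r // subrK !lexx.
rewrite trap_out ?scale0r //; first by lra.
by move: xt; rewrite ler_normr => /orP[] h; [right|left]; lra.
Unshelve. all: by end_near. Qed.

(** Test u with a bump at t multiplied by a functional supporting N at b. *)
Lemma jump_le N u (t : R) b : is_norm N -> L1v T u -> (TV T N u <= 1)%E ->
  0 < t < T -> cls T u = cls T (step T t b) -> N b <= 1.
Proof.
move=> hN hu uN tT ub.
have [p [pb pN]] := support_functional _ N b (is_norm_sublinear _ N hN).
have pN' c : N c <= 1 -> dot (- p) c <= 1.
  by move=> Nc; rewrite dotNl -dotNr (le_trans (pN _)) // is_normN.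
have [Psi [CPsi aPsi] [Psit _]] := bump_admissible N t 1 (- p) tT ltr01 pN'.
have := (TV_leP T T0 N u 1 hu).1 uN Psi (conj CPsi aPsi).
have /andP[/ltW t0 /ltW tT'] := tT.
rewrite (pairing_cls _ _ _ hu (L1v_step T t b) CPsi ub) pairing_step ?t0 //.
by rewrite Psit dotNr opprK dotC pb.
Qed.

Lemma leb_const_ae u (x y : R) : L1v T u -> x < y ->
  (forall z w, x < z < y -> x < w < y -> leb_pt T u z -> leb_pt T u w -> u z = u w) ->
  exists a, \forall z \ae mu, x < z < y -> u z = a.
Proof.
move=> hu xy H; have ae := ae_leb_pt T u hu.
have [w xwy lw] := ae_itv_ex _ _ _ xy ae.
exists (u w); have F := @ae_lebesgue_filter R.
by apply: filterS ae => z lz xzy; exact: H.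
Qed.

Lemma leb_const_step u (t : R) : L1v T u -> 0 < t < T ->
  (forall z w, 0 < z < t -> 0 < w < t -> leb_pt T u z -> leb_pt T u w -> u z = u w) ->
  (forall z w, t < z < T -> t < w < T -> leb_pt T u z -> leb_pt T u w -> u z = u w) ->
  exists b, cls T u = cls T (step T t b).
Proof.
move=> hu /andP[t0 tT] H1 H2.
have [a ha] := leb_const_ae u 0 t hu t0 H1.
have [b hb] := leb_const_ae u t T hu tT H2.
by exists (b - a); exact: cls_two_constants.
Qed.

End Steps.

(** * Extremal points of the ball *)

Section Extremal.
Context {R : realType} {n : nat} (T : R).
Local Notation mu := (@lebesgue_measure R).
Local Notation Om := (Omega T).
Local Notation vec := 'rV[R]_n.
Implicit Types (u v G Phi Psi : R -> vec) (N : vec -> R) (a b c p : vec).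

Hypothesis T0 : 0 < T.

(** A point of norm less than 1 is either 0, the midpoint of two opposite unit
    vectors, or lies strictly between 0 and its normalization. *)
Lemma unit_ball_ext_norm N b : (0 < n)%N -> is_norm N ->
  Ext (unit_ball N) b -> N b = 1.
Proof.
move=> n0 hN [Nb extb].
have Nge0 a : 0 <= N a by exact: is_norm_ge0.
have N0 : N 0 = 0 by exact: sublinear0 (is_norm_sublinear _ N hN).
have unit a : a != 0 -> N ((N a)^-1 *: a) = 1.
  move=> a0; rewrite (is_norm_homog hN) ger0_norm ?invr_ge0 // mulVf //.
  by apply: contra_neq a0 => /(is_norm_eq0 hN).
have [b0|b0] := eqVneq b 0; last first.
  have h01 : 0 <= N b <= 1 by rewrite Nge0.
  have Nb0 : N b != 0 by apply: contra_neq b0 => /(is_norm_eq0 hN).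
  have := extb ((N b)^-1 *: b) 0 (N b);
    rewrite /unit_ball /= unit // N0 => /(_ (lexx _) ler01 h01).
  rewrite scaler0 addr0 scalerA mulfV // scale1r => /(_ erefl)[bE|/eqP];
    last by rewrite (negPf b0).
  by rewrite bE unit.
pose e : vec := \row_j (j == Ordinal n0)%:R.
have e0 : e != 0.
  apply/eqP => /rowP /(_ (Ordinal n0)); rewrite !mxE eqxx => /eqP.
  by rewrite oner_eq0.
have v1 := unit e e0; set v := _ *: e in v1.
have h01 : 0 <= (2^-1 : R) <= 1 by lra.
have bv : b = 2^-1 *: v + (1 - 2^-1) *: (- v).
  by rewrite b0 scalerN -scalerBl (_ : _ - _ = 0) ?scale0r //; field.
have /(_ _ _)[] := extb v (- v) 2^-1 _ _ h01 bv.
- by rewrite /unit_ball /= v1.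
- by rewrite /unit_ball /= is_normN // v1.
- by move=> bv'; move: v1; rewrite -bv' b0 N0 => /eqP; rewrite eq_sym oner_eq0.
- by move=> bv'; move: v1; rewrite -is_normN // -bv' b0 N0 => /eqP;
    rewrite eq_sym oner_eq0.
Qed.

(** If Psi is a narrow bump with value p at t, and Phi is supported away from t,
    then Phi + Psi is still admissible. Testing u with Psi already gives the
    maximal value 1, so that testing with Phi cannot give more than 0, and u
    is constant on each side of t. *)
Lemma saturated_step N u (t : R) p : is_norm N -> L1v T u -> (TV T N u <= 1)%E ->
  0 < t < T -> (forall c, N c <= 1 -> dot p c <= 1) ->
  (forall Phi, admissible T N Phi -> Phi t = p -> 1 <= pairing T u Phi) ->
  exists b, cls T u = cls T (step T t b).
Proof.
move=> hN hu uN tT pN H; have /andP[t0 tT'] := tT.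
have key Phi (a' b' : R) : admissible T N Phi -> supported_in Phi a' b' ->
    b' < t \/ t < a' -> pairing T u Phi <= 0.
  move=> [CPhi aPhi] sPhi ht.
  have [d d0 hd] : exists2 d : R, 0 < d & forall x, Phi x != 0 -> d <= `|x - t|.
    case: ht => ht; [exists (t - b')|exists (a' - t)]; rewrite ?subr_gt0 //.
      by move=> x /sPhi /andP[_ xb]; rewrite distrC (le_trans _ (ler_norm _)) //
        lerD2l lerN2.
    by move=> x /sPhi /andP[ax _]; rewrite (le_trans _ (ler_norm _)) // lerD2r.
  have [Psi [CPsi aPsi] [Psit Psi0]] := bump_admissible T T0 N t d p tT d0 pN.
  have Phit : Phi t = 0.
    apply/eqP/negPn/negP => /hd; rewrite subrr normr0 => /(lt_le_trans d0).
    by rewrite ltxx.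
  have aS : admissible T N (Phi + Psi).
    split; first exact: C1cD.
    move=> x c Nc; have -> : (Phi + Psi) x = Phi x + Psi x by [].
    have [->|/hd /Psi0 ->] := eqVneq (Phi x) 0; first by rewrite add0r; exact: aPsi.
    by rewrite addr0; exact: aPhi.
  have le1 := (TV_leP T T0 N u 1 hu).1 uN _ aS.
  have ge1 := H Psi (conj CPsi aPsi) Psit.
  rewrite (pairingDr T T0 u Phi Psi hu CPhi CPsi) in le1.
  by rewrite -(lerD2r (pairing T u Psi)) add0r (le_trans le1).
apply: leb_const_step => // z w hz hw lz lw.
  apply: (leb_pt_const T T0 N u 0 t) => // [|Phi a' b' aPhi ta b't sPhi];
    first exact: ltW.
  by apply: key sPhi _ => //; left.
apply: (leb_pt_const T T0 N u t T) => // [|Phi a' b' aPhi ta b't sPhi];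
  first exact: ltW.
by apply: key sPhi _ => //; right.
Qed.

Lemma cls_comb (l : R) u v :
  cls T (l *: u + (1 - l) *: v) = l *: cls T u + (1 - l) *: cls T v.
Proof. by rewrite clsD !clsZ. Qed.

(** If the step is a convex combination of u1 and u2, test with - p at t, where
    p supports N at b: both u1 and u2 must attain the maximal value 1, so
    both jump only at t. The claim is then extremality of b. *)
Lemma step_extreme N (t : R) b : (0 < n)%N -> is_norm N -> 0 < t < T ->
  Ext (unit_ball N) b -> Ext (TV_ball T N) (cls T (step T t b)).
Proof.
move=> n0 hN tT extb; have Nb1 := unit_ball_ext_norm N b n0 hN extb.
have tT' : 0 <= t <= T by case/andP: tT => /ltW -> /ltW ->.
split; first by apply: step_in_ball => //; rewrite Nb1.
move=> _ _ l [u1 [[h1 _] N1] <-] [u2 [[h2 _] N2] <-] /andP[l0 l1].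
have [->|ln0] := eqVneq l 0; first by rewrite scale0r add0r subr0 scale1r; right.
have [->|ln1] := eqVneq l 1; first by rewrite subrr scale0r addr0 scale1r; left.
have {l0}l0 : 0 < l by rewrite lt_def ln0.
have {l1}l1 : 0 < 1 - l by rewrite subr_gt0 lt_def eq_sym ln1.
have [p [pb pN]] := support_functional _ N b (is_norm_sublinear _ N hN).
have pN' c : N c <= 1 -> dot (- p) c <= 1.
  by move=> Nc; rewrite dotNl -dotNr (le_trans (pN _)) // is_normN.
move=> q.
have hv : L1v T (l *: u1 + (1 - l) *: u2) by apply: L1vD; exact: L1vZ.
have sum1 Phi : admissible T N Phi -> Phi t = - p ->
    [/\ l * pairing T u1 Phi + (1 - l) * pairing T u2 Phi = 1,
        pairing T u1 Phi <= 1 & pairing T u2 Phi <= 1].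
  move=> aPhi Phit; have [CPhi _] := aPhi; split.
  - rewrite -!pairingZl // -pairingDl //; try exact: L1vZ.
    rewrite -(pairing_cls T T0 (step T t b)) //;
      [|exact: L1v_step|by rewrite cls_comb].
    by rewrite pairing_step // Phit dotNr opprK dotC pb.
  - exact: (TV_leP T T0 N u1 1 h1).1 N1 Phi aPhi.
  - exact: (TV_leP T T0 N u2 1 h2).1 N2 Phi aPhi.
have [b1 e1] : exists b1, cls T u1 = cls T (step T t b1).
  apply: (saturated_step N u1 t (- p)) => // Phi aPhi /(sum1 _ aPhi)[+ _].
  move: (pairing T u1 Phi) (pairing T u2 Phi) => P1 P2; nra.
have [b2 e2] : exists b2, cls T u2 = cls T (step T t b2).
  apply: (saturated_step N u2 t (- p)) => // Phi aPhi /(sum1 _ aPhi)[+ + _].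
  move: (pairing T u1 Phi) (pairing T u2 Phi) => P1 P2; nra.
have Nb1' := jump_le T T0 N u1 t b1 hN h1 N1 tT e1.
have Nb2' := jump_le T T0 N u2 t b2 hN h2 N2 tT e2.
have bE : b = l *: b1 + (1 - l) *: b2.
  apply: (step_inj T t) => //.
  by rewrite q e1 e2 stepD !stepZ cls_comb.
rewrite e1 e2; have l01 : 0 <= l <= 1 by rewrite ltW //= -subr_ge0 ltW.
by case: (extb.2 b1 b2 l Nb1' Nb2' l01 bE) => <-; [left|right].
Qed.

Lemma derive1_supported Phi (x y z : R) : supported_in Phi x y ->
  derive1 Phi z <> 0 -> x <= z <= y.
Proof.
move=> sPhi dPhi; apply: contrapT => /negP xzy; apply: dPhi.
rewrite derive1E -(derive_cst (0 : vec) z 1); apply: near_eq_derive.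
have : nbhs z (~` `[x, y]).
  apply: open_nbhs_nbhs; split; first by apply: closed_openC; exact: interval_closed.
  by rewrite /= in_itv /=; exact/negP.
apply: filterS => w /=; rewrite in_itv /= => /negP.
by apply: contraNeq => /sPhi.
Qed.

Lemma TV_scale N u (k c : R) : 0 <= k -> L1v T u -> (TV T N u <= c%:E)%E ->
  (TV T N (k *: u) <= (k * c)%:E)%E.
Proof.
move=> k0 hu uc; apply/(TV_leP T T0); first exact: L1vZ.
move=> Phi aPhi; rewrite pairingZl ?ler_wpM2l //; last by case: aPhi.
exact: (TV_leP T T0 N u c hu).1 uc Phi aPhi.
Qed.

(** Extremality says that u equals a multiple of one of its cut parts up to
    a constant; on the side where that part is u minus a constant, this
    equation determines u. *)
Lemma affine_fixpoint (V : lmodType R) (k : R) (x y z : V) : k != 1 ->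
  x = k *: (x - y) + z -> x = (1 - k)^-1 *: (z - k *: y).
Proof.
move=> k1 xE; have kn : 1 - k != 0 by rewrite subr_eq0 eq_sym.
rewrite -[LHS](scalerK kn); congr (_ *: _).
by rewrite scalerBl scale1r {1}xE scalerBr addrAC [X in X + _]addrAC subrr add0r
  addrC.
Qed.

(** Cutting u at s writes its class as v q1 + (1 - v) q2, where v is the
    variation of u before s. If v is 0 or 1 then one side of u is constant.
    Otherwise extremality gives u = q1 or u = q2, and u is constant on both
    sides of s. *)
Lemma extreme_trichotomy N u (s : R) : is_norm N -> BV T u -> (TV T N u <= 1)%E ->
  Ext (TV_ball T N) (cls T u) -> Om s -> leb_pt T u s ->
  [\/ exists b, cls T u = cls T (step T s b),
      forall z w, 0 < z < s -> 0 < w < s -> leb_pt T u z -> leb_pt T u w -> u z = u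
        w |
      forall z w, s < z < T -> s < w < T -> leb_pt T u z -> leb_pt T u w -> u z = u
        w].
Proof.
move=> hN [hu uBV] uN [_ extq] Os ls.
have := Os; rewrite /Omega /= in_itv /= => /andP[s0 sT].
have hl := L1v_cut_left T s u hu; have hr := L1v_cut_right T s u hu.
have [v /andP[v0 v1] [vl vr]] := TV_cut T T0 N u s 1 hu Os ls uN.
have [e ue] : exists e : R, (TV T (@euclid R n) u <= e%:E)%E.
  by move: uBV; case: (TV _ _ _) => [e| |] //; [exists e|exists 0; rewrite leNye].
(* The parts must be shown to be in BV, which is defined by the Euclidean norm. *)
have [w /andP[w0 we] [wl wr]] := TV_cut T T0 (@euclid R n) u s e hu Os ls ue.
have pu Phi : C1c T Phi -> pairing T u Phi = pairing T (fun x => u x - u s) Phi.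
  by move=> CPhi; rewrite [RHS](pairingDl T T0 u (fun=> - u s)) ?pairing_cst ?addr0
    //; exact: L1v_cst.
have [v00|vn0] := eqVneq v 0.
  apply: Or32 => z y hz hy lz ly; apply: (leb_pt_const T T0 N u 0 s) => //;
    first exact: ltW.
  move=> Phi a' b' aPhi a0 bs sPhi; have [CPhi _] := aPhi.
  rewrite v00 in vl; have := (TV_leP T T0 N _ 0 hl).1 vl Phi aPhi.
  rewrite pu // (pairing_eq T _ (cut_left s u) Phi CPhi) // => x _.
  move=> /(derive1_supported _ _ _ _ sPhi) /andP[_ xb].
  by rewrite /cut_left (le_lt_trans xb bs) scale1r.
have [v11|vn1] := eqVneq v 1.
  apply: Or33 => z y hz hy lz ly; apply: (leb_pt_const T T0 N u s T) => //;
    first exact: ltW.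
  move=> Phi a' b' aPhi sa bT sPhi; have [CPhi _] := aPhi.
  rewrite v11 subrr in vr; have := (TV_leP T T0 N _ 0 hr).1 vr Phi aPhi.
  rewrite pu // (pairing_eq T _ (cut_right s u) Phi CPhi) // => x _.
  move=> /(derive1_supported _ _ _ _ sPhi) /andP[ax _].
  by rewrite /cut_right ltNge (ltW (lt_le_trans sa ax)) subr0 scale1r.
apply: Or31.
have {}v0 : 0 < v by rewrite lt_def vn0.
have {}v1 : 0 < 1 - v by rewrite subr_gt0 lt_def eq_sym vn1.
have in_ball x (k c : R) : 0 < k -> L1v T x -> (TV T N x <= k%:E)%E ->
    (TV T (@euclid R n) x <= c%:E)%E -> TV_ball T N (cls T (k^-1 *: x)).
  move=> k0 hx xk xc; exists (k^-1 *: x) => //.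
  have ki : 0 <= k^-1 by rewrite invr_ge0 ltW.
  split; last first.
    by apply: le_trans (TV_scale _ _ _ _ ki hx xk) _; rewrite mulVf ?gt_eqF.
  split; first exact: L1vZ.
  exact: le_lt_trans (TV_scale _ _ _ _ ki hx xc) (ltry _).
have bl := in_ball _ v w v0 hl vl wl.
have br := in_ball _ (1 - v) (e - w) v1 hr vr wr.
have v01 : 0 <= v <= 1 by rewrite ltW //= -subr_ge0 ltW.
have uE : cls T u = v *: cls T (v^-1 *: cut_left s u) +
    (1 - v) *: cls T ((1 - v)^-1 *: cut_right s u).
  rewrite -!clsZ !scalerA !mulfV ?gt_eqF // !scale1r -clsD; apply/clsP; exists (u s).
  apply: aeW => x _;
    rewrite [X in _ = X + _](_ : _ = cut_left s u x + cut_right s u x) //.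
  by rewrite /cut_left /cut_right -scalerDl addrCA subrr addr0 scale1r subrK.
have F := @ae_lebesgue_filter R.
case: (extq _ _ v bl br v01 uE) => /clsP[a ha].
- exists (a - (1 - v^-1)^-1 *: (a - v^-1 *: u s)); apply: cls_two_constants.
    apply: filterS ha => x hx /andP[x0 xs]; apply: affine_fixpoint.
      by rewrite invr_eq1.
    rewrite {1}hx; last by rewrite /Omega /= in_itv /= x0 (lt_trans xs).
    by rewrite [X in X + _ = _](_ : _ = v^-1 *: cut_left s u x) // /cut_left xs
      scale1r.
  apply: filterS ha => x hx /andP[sx xT].
  rewrite hx; last by rewrite /Omega /= in_itv /= xT (lt_trans s0).
  rewrite [X in X + _ = _](_ : _ = v^-1 *: cut_left s u x) // /cut_left.
  by rewrite ltNge (ltW sx) scale0r scaler0 add0r.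
- exists ((1 - (1 - v)^-1)^-1 *: (a - (1 - v)^-1 *: u s) - a);
    apply: cls_two_constants.
    apply: filterS ha => x hx /andP[x0 xs].
    rewrite hx; last by rewrite /Omega /= in_itv /= x0 (lt_trans xs).
    rewrite [X in X + _ = _](_ : _ = (1 - v)^-1 *: cut_right s u x) // /cut_right.
    by rewrite xs subrr scale0r scaler0 add0r.
  apply: filterS ha => x hx /andP[sx xT]; apply: affine_fixpoint.
    by rewrite invr_eq1 subr_eq -subr_eq0 opprD addrA subrr sub0r oppr_eq0.
  rewrite {1}hx; last by rewrite /Omega /= in_itv /= xT (lt_trans s0).
  rewrite [X in X + _ = _](_ : _ = (1 - v)^-1 *: cut_right s u x) // /cut_right.
  by rewrite ltNge (ltW sx) subr0 scale1r.
Qed.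

(** If no Lebesgue point is already the place of the jump, let t be the
    supremum of the points before which u is constant: u is then constant
    before t and, by the trichotomy, after t. *)
Lemma extreme_is_step N (q : mod_const T n) : is_norm N -> Ext (TV_ball T N) q ->
  exists t b, 0 < t < T /\ q = cls T (step T t b).
Proof.
move=> hN extq; have [[u [uBV uN] uq] _] := extq; rewrite -uq in extq *.
have [hu _] := uBV.
have [[s [b [sT sb]]]|nostep] :=
    pselect (exists s b, 0 < s < T /\ cls T u = cls T (step T s b)).
  by exists s, b.
pose left s := forall z w, 0 < z < s -> 0 < w < s ->
  leb_pt T u z -> leb_pt T u w -> u z = u w.
pose right s := forall z w, s < z < T -> s < w < T ->
  leb_pt T u z -> leb_pt T u w -> u z = u w.
have dich s : Om s -> leb_pt T u s -> left s \/ right s.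
  move=> Os ls; have [[b sb]||] := extreme_trichotomy N u s hN uBV uN extq Os ls;
    [|by left|by right].
  by exfalso; apply: nostep; exists s, b.
pose A := [set s | 0 <= s <= T /\ left s].
have A0 : A 0.
  by split; [rewrite lexx ltW|move=> z w /andP[z0 z0']; have := lt_trans z0 z0';
    rewrite ltxx].
have supA : has_sup A by split; [exists 0|exists T => s [/andP[]]].
pose t := sup A.
have t0 : 0 <= t by exact: sup_upper_bound.
have tT : t <= T by apply: ge_sup => [|s [/andP[]]//]; exists 0.
have left_t z w : 0 < z < t -> 0 < w < t -> leb_pt T u z -> leb_pt T u w -> u z = u w.
  move=> /andP[z0 zt] /andP[w0 wt] lz lw.
  have m0 : 0 < t - Num.max z w by rewrite subr_gt0 gt_max zt.
  have [s [_ ls]] := sup_adherent m0 supA.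
  rewrite -/t opprB addrC subrK gt_max => /andP[zs ws].
  by apply: ls; rewrite ?z0 ?w0.
have right_t z w : t < z < T -> t < w < T -> leb_pt T u z -> leb_pt T u w ->
    u z = u w.
  move=> /andP[tz zT] /andP[tw wT] lz lw.
  have tm : t < Num.min z w by rewrite lt_min tz.
  have [s /andP[ts]] := ae_itv_ex _ _ _ tm (ae_leb_pt T u hu).
  rewrite lt_min => /andP[sz sw] ls.
  have s0 := le_lt_trans t0 ts; have sT := lt_trans sz zT.
  have Os : Om s by rewrite /Omega /= in_itv /= s0.
  have [lefts|] := dich s Os ls; last by apply; rewrite ?sz ?sw.
  have : s <= t by apply: sup_upper_bound => //; split => //; rewrite !ltW.
  by rewrite leNgt ts.
have T2 : 0 < T / 2 < T by rewrite divr_gt0 //= gtr_pMr // invf_lt1 // ltr1n.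
(* If t is an end of the interval, u is constant and any jump point will do. *)
have [t' [t'T l' r']] : exists t', [/\ 0 < t' < T, left t' & right t'].
  have [t00|tn0] := eqVneq t 0.
    rewrite t00 in right_t; have /andP[h0 hT] := T2.
    exists (T / 2); split => // z w /andP[z1 z2] /andP[w1 w2]; apply: right_t.
    - by rewrite z1 (lt_trans z2).
    - by rewrite w1 (lt_trans w2).
    - by rewrite z2 (lt_trans h0).
    - by rewrite w2 (lt_trans h0).
  have [tTT|tnT] := eqVneq t T.
    rewrite tTT in left_t; have /andP[h0 hT] := T2.
    exists (T / 2); split => // z w /andP[z1 z2] /andP[w1 w2]; apply: left_t.
    - by rewrite z1 (lt_trans z2).
    - by rewrite w1 (lt_trans w2).
    - by rewrite z2 (lt_trans h0).
    - by rewrite w2 (lt_trans h0).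
  by exists t; split => //; rewrite !lt_neqAle t0 tT tnT eq_sym tn0.
by have [b hb] := leb_const_step T u t' hu t'T l' r'; exists t', b.
Qed.

End Extremal.

Theorem theorem3p3 (R : realType) (T : R) (hT : 0 < T) (n : nat) (hn : (0 < n)%N)
    (N : 'rV[R]_n -> R) (hN : is_norm N) :
  Ext (TV_ball T N) =
  [set q | exists (t : R) (b : 'rV[R]_n),
      [/\ 0 < t < T, Ext (unit_ball N) b & q = cls T (step T t b)]].
Proof.
apply/seteqP; split=> [q extq|q [t [b [tT extb ->]]]]; last exact: step_extreme.
have [t [b [tT qE]]] := extreme_is_step T hT N q hN extq.
exists t, b; split=> //; have [[u [[hu _] uN] uq] ext] := extq.
have tT' : 0 <= t <= T by case/andP: tT => /ltW -> /ltW ->.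
split; first by apply: (jump_le T hT N u t b) => //; rewrite uq.
move=> b1 b2 l Nb1 Nb2 l01 bE.
have B1 := step_in_ball T hT N t b1 hN tT' Nb1.
have B2 := step_in_ball T hT N t b2 hN tT' Nb2.
have qE' : q = l *: cls T (step T t b1) + (1 - l) *: cls T (step T t b2).
  by rewrite qE bE stepD !stepZ cls_comb.
by case: (ext _ _ l B1 B2 l01 qE'); rewrite qE => /(step_inj T t _ _ tT);
  [left|right].
Qed.
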